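(* Let $a \in \mathbb{C}\setminus\{\frac12,\frac32,\frac52,\dots\}$ and $z \in \mathbb{C}$, set $b = -4(a-\frac12)$, let $t_0$ be one of the two numbers $t_\pm = \frac12\big(z \pm \sqrt{z^2-b}\big)$, and let $d=d(z), \rho, \beta, \delta, f$ and $\kappa$ be as defined in the context. Suppose that the phases $\beta$ and $\delta$ are such that $\kappa$ is positive, and let $\alpha \in [0,\pi)$ be a corresponding angle as in the context. Let $$U_a(z) = \begin{cases} U_a^+(z) & \text{if } \mathrm{Re}(t_0 e^{i\alpha}) < 0,\\ U_a^-(z) & \text{if } \mathrm{Re}(t_0 e^{i\alpha}) \geq 0,\end{cases} \qquad \tilde{U}_a(z) = e^{-\frac{z^2}{4} + f(t_0)}\; t_0\; \frac{2\sqrt{2\pi}}{\sqrt{-8d-b}},$$ with an appropriate choice of the sign of the square root $\sqrt{-8d-b}$. Then $$\left| \frac{d}{dz}\bigg( \frac{U_a(z)}{\tilde{U}_a(z)} \bigg) \right| \leq \frac{|b|\,|d'(z)|}{\kappa^2|d|^2\sqrt{|8d+b|}} \left(1 + \log^2\bigg(1 + \frac{(\kappa|d|)^{3/2}}{|b|}\bigg)\right) + \frac{|b|\,|d'(z)|}{\kappa^3|d|^3}\,\sqrt{|8d+b|}\left(1 + \log^3\bigg(1+\frac{(\kappa|d|)^{3/2}}{|b|}\bigg)\right).$$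
   Context: The parabolic cylinder functions are $$U_a^\pm(z) = e^{-\frac{z^2}{4}} \int_{\Gamma_\pm} e^{zt - \frac{t^2}{2}}\, t^{a-\frac12}\,dt = e^{-\frac{z^2}{4}} \int_{\Gamma_\pm} e^{f(t)}\,dt, \qquad \Gamma_\pm = \mathbb{R} \pm i,$$ with $\Gamma_\pm$ running from $-\infty\pm i$ to $\infty \pm i$, where $t^{a-\frac12} = \exp((a-\frac12)\log t)$, the logarithm has its branch cut along the negative real axis, and $$f(t) = zt - \frac{t^2}{2} - \frac{b}{4}\log t.$$ The points $t_\pm$ are the zeros of $f'$; since $b\ne 0$, $t_\pm \neq 0$. Set $$d = d(z) := -\frac{t_0^2}{2} = -\frac18\big(z\pm\sqrt{z^2-b}\big)^2, \qquad \rho := \left|\frac{b}{8d}\right|, \qquad b = |b|e^{i\beta},\quad d = |d|e^{i\delta} \quad\text{with } \beta,\delta \in [-\pi,\pi].$$ Here $a$ is fixed, $d'(z)$ is the $z$-derivative of $d$, and the branches (of $t_0$ and of $\sqrt{-8d-b}$) and the choice of $U_a^+$ or $U_a^-$ are kept fixed locally when differentiating. One parametrizes $t = t_0(1+\tau)$ with $\tau = e^{i\alpha}u$, $u \in \mathbb{R}$, $\alpha\in[0,\pi)$; on this line $$f(t) - f(t_0) = -\frac{t_0^2}{2}\tau^2 + \frac{b}{4}\big(\tau - \log(1+\tau)\big).$$ The parameter $\kappa$ is given by $$\kappa = \begin{cases} 1 - \rho\,\dfrac{\sin^2\left(\frac{\beta}{2} - \frac{\delta}{4}\right)}{\cos\frac{\delta}{2}}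 & \text{if } \delta \in \left(-\frac{2\pi}{3}, \frac{2\pi}{3}\right),\\[1em] -\cos\left(\delta \pm \frac{\pi}{3}\right) - 2\rho\left(1 \mp \sin\left(\beta \pm \frac{\pi}{6}\right)\right) & \text{if } \delta \notin \left(-\frac{2\pi}{3}, \frac{2\pi}{3}\right),\end{cases}$$ where in the second case one may choose the upper or the lower signs as desired; if $\rho < 1/8$, one may instead choose $\kappa = 1/4$. A corresponding angle $\alpha\in[0,\pi)$ is one for which $$\sin\alpha \geq \tfrac12 \qquad\text{and}\qquad \mathrm{Re}\big(f(t) - f(t_0)\big) \leq -\kappa\,|d|\,|\tau|^2 \quad \text{for all } \tau = e^{i\alpha}u,\ u \in \mathbb{R},\ t = t_0(1+\tau).$$
   Formalization: In f, and so in e^{f(t_0)}, log is not the principal branch but its continuation from the chosen contour R+i (R-i) to the plane cut along the negative (positive) imaginary axis; with the principal branch f(t_0) jumps when t_0 crosses the negative real axis. *)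

(* Defs.v *)
From Stdlib Require Import Reals Lra.
From Coquelicot Require Import Coquelicot.
Open Scope R_scope.

Definition Cexp (z : C) : C :=
  (exp (Re z) * cos (Im z), exp (Re z) * sin (Im z)).

(* Principal argument, with values in (-PI, PI] for z <> 0. *)
Definition Arg (z : C) : R :=
  if Rlt_dec (Im z) 0 then - acos (Re z / Cmod z) else acos (Re z / Cmod z).

(* Principal logarithm: the branch cut is the negative real axis. *)
Definition Clog (z : C) : C := (ln (Cmod z), Arg z).

Definition Cpower (t e : C) : C := Cexp (e * Clog t)%C.

Inductive contour : Set := Gamma_plus | Gamma_minus.

(* Parametrization of R + i, resp. R - i, by the real part. *)
Definition gamma (s : contour) (x : R) : C :=
  match s with Gamma_plus => (x, 1) | Gamma_minus => (x, -1) end.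

Definition U (s : contour) (a z : C) : C :=
  (Cexp (- (z ^ 2 / 4)) *
   RInt_gen (V := C_R_CompleteNormedModule)
     (fun x : R => let t := gamma s x in
        Cexp (z * t - t ^ 2 / 2) * Cpower t (a - 1 / 2))
     (Rbar_locally m_infty) (Rbar_locally p_infty))%C.

(* The continuation of the principal logarithm from R + i (resp. R - i) to the
   plane cut along the negative (resp. positive) imaginary axis.  The principal
   branch cannot be used here: the steepest-descent line replacing the contour,
   and the saddle point on it, may lie on or beyond the negative real axis. *)
Definition Clog_cont (s : contour) (t : C) : C :=
  match s with
  | Gamma_plus => (Clog (- Ci * t) + Ci * (PI / 2))%C
  | Gamma_minus => (Clog (Ci * t) - Ci * (PI / 2))%C
  end.

Definition phase (s : contour) (b z t : C) : C :=
  (z * t - t ^ 2 / 2 - b / 4 * Clog_cont s t)%C.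

(* [r] is, near [z], a continuous branch of the square root of [g]. *)
Definition sqrt_branch (g : C -> C) (z : C) (r : C -> C) : Prop :=
  locally z (fun w => (r w ^ 2)%C = g w /\ continuous r w).

Definition is_kappa (rho beta delta kappa : R) : Prop :=
  (- (2 * PI / 3) < delta < 2 * PI / 3 /\
   kappa = 1 - rho * (sin (beta / 2 - delta / 4)) ^ 2 / cos (delta / 2))
  \/
  (~ (- (2 * PI / 3) < delta < 2 * PI / 3) /\
   (kappa = - cos (delta + PI / 3) - 2 * rho * (1 - sin (beta + PI / 6)) \/
    kappa = - cos (delta - PI / 3) - 2 * rho * (1 + sin (beta - PI / 6))))
  \/
  (rho < 1 / 8 /\ kappa = 1 / 4).

Definition corresponding_angle (f : C -> C) (t0 d : C) (kappa alpha : R)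
    : Prop :=
  0 <= alpha < PI /\
  1 / 2 <= sin alpha /\
  forall u : R,
    let tau := (Cexp (Ci * alpha) * u)%C in
    Re (f (t0 * (1 + tau)) - f t0)%C <= - kappa * Cmod d * Cmod tau ^ 2.

Definition contour_of (t0 : C) (alpha : R) : contour :=
  if Rlt_dec (Re (t0 * Cexp (Ci * alpha))%C) 0 then Gamma_plus else Gamma_minus.

(* Main.v *)
Require Import Defs.
From Stdlib Require Import Reals Lra FunctionalExtensionality.
From Coquelicot Require Import Coquelicot.
Open Scope R_scope.

(** The ratio has an explicit derivative. Both saddle points [t0] and [w - t0]
    satisfy [4 * t0 * (w - t0) = b], so near [z]
[[
  U w / Utilde w = sq w / (2 * sqrt (2 * PI) * t0 w)
                   * exp (- phase w (t0 w)) * V w,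
]]
    where [V w] is the integral of [exp (phase w t)] along the horizontal
    contour. Differentiation under the integral sign multiplies the integrand
    by [t] ([gaussian_integral_hol_derive]), and the critical value
    [phase w (t0 w)] has derivative [t0 w] ([critical_value_derive]). The
    derivative of the ratio at [z] is therefore [exp (- phase z t0)] over
    [2 * sqrt (2 * PI)] times the integral of
    [(4 * b / sq ^ 3 + sq * tau) * exp (phase z t)], with [t = t0 * (1 + tau)]
    ([ratio_derive]). All of this takes place on the fixed horizontal contour.

    For the fixed point [z] that integral is moved to the line
    [tau = exp (i * alpha) * u], by Cauchy's theorem ([deformation]). The
    hypothesis on [alpha] forces the line to be flatter than the diagonals
    ([saddle_line_slope]), which makes the integrand decay between the two
    lines, and [sin alpha > 0] determines on which side of the origin the line
    passes ([saddle_line_cross]), so that the cut of the logarithm is avoided.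

    On the line the linear factor is the sum of the derivative of a decaying
    function and of a multiple of [tau ^ 3 / (1 + tau)]
    ([boundary_derive]). There [Cmod (1 + tau) >= sin alpha >= 1 / 2] and the
    exponential is at most [exp (- D * u ^ 2)], [D = kappa * Cmod d], relative
    to its value at the saddle point; the integral of
    [2 * Rabs u ^ 3 * exp (- D * u ^ 2)] is [2 / D ^ 2] ([saddle_estimate]).
    The outcome is
    [Cmod b * Cmod d' / (sqrt (2 * PI) * kappa ^ 2 * Cmod d ^ 2 * q)], which is
    at most the first summand of the bound.

    The divisions by [sq z] and by [sqrt (z ^ 2 - b)] are legitimate because at
    a double saddle point the exponent would vary only to third order along the
    line, against its quadratic decay ([saddle_nondegenerate]). *)

Local Notation path_derive f s l :=
  (is_derive (K := R_AbsRing) (V := C_R_NormedModule) f s l).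
Local Notation hol_derive f z l :=
  (is_derive (K := C_AbsRing) (V := C_NormedModule) f z l).
Local Notation Ccontinuous f x := (continuous (U := C_UniformSpace) f x).
Local Notation CCcontinuous f x :=
  (continuous (T := C_UniformSpace) (U := C_UniformSpace) f x).
Local Notation is_path_int f a b l :=
  (is_RInt (V := C_R_NormedModule) f a b l).

(** * Complex numbers and the exponential *)

Lemma Cmod_minus_sym (x y : C) : Cmod (x - y) = Cmod (y - x).
Proof. rewrite <- Cmod_opp. f_equal. ring. Qed.

Lemma Re_le_Cmod (x : C) : Re x <= Cmod x.
Proof. generalize (re_le_Cmod x), (Rle_abs (Re x)); lra. Qed.

Lemma Cmod_Im_le (x : C) : Rabs (Im x) <= Cmod x.
Proof.
  eapply Rle_trans; [ | apply Rmax_Cmod]. apply Rmax_r.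
Qed.

Lemma Cmod_le_ReIm (x : C) : Cmod x <= Rabs (Re x) + Rabs (Im x).
Proof.
  assert (H : Cmod x ^ 2 = Re x ^ 2 + Im x ^ 2) by apply Cmod2_alt.
  rewrite <- (pow2_abs (Re x)), <- (pow2_abs (Im x)) in H.
  generalize (Rabs_pos (Re x)), (Rabs_pos (Im x)), (Cmod_ge_0 x).
  nra.
Qed.

Lemma C_eq (x y : C) : Re x = Re y -> Im x = Im y -> x = y.
Proof. destruct x, y; simpl; intros -> ->; reflexivity. Qed.

Lemma Cmod_Cexp (x : C) : Cmod (Cexp x) = exp (Re x).
Proof.
  unfold Cmod, Cexp; cbn [fst snd].
  replace ((exp (Re x) * cos (Im x)) ^ 2 + (exp (Re x) * sin (Im x)) ^ 2)
    with (exp (Re x) ^ 2 * (Rsqr (sin (Im x)) + Rsqr (cos (Im x))))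
    by (unfold Rsqr; ring).
  rewrite sin2_cos2, Rmult_1_r. apply sqrt_pow2, Rlt_le, exp_pos.
Qed.

Lemma Cexp_plus (x y : C) : Cexp (x + y) = (Cexp x * Cexp y)%C.
Proof.
  apply C_eq; unfold Cexp, Re, Im; simpl; rewrite exp_plus, ?cos_plus, ?sin_plus; ring.
Qed.

Lemma Cexp_0 : Cexp 0 = 1%C.
Proof. apply C_eq; unfold Cexp, Re, Im; simpl; rewrite exp_0, ?cos_0, ?sin_0; ring. Qed.

Lemma Cexp_neq_0 (x : C) : Cexp x <> 0%C.
Proof. apply Cmod_gt_0. rewrite Cmod_Cexp. apply exp_pos. Qed.

Lemma Cexp_opp (x : C) : Cexp (- x) = (/ Cexp x)%C.
Proof.
  assert (H : (Cexp (- x) * Cexp x)%C = 1%C).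
  { rewrite <- Cexp_plus, <- Cexp_0. f_equal. ring. }
  rewrite <- (Cmult_1_r (Cexp (-x))).
  rewrite <- (Cinv_r (Cexp x)) by apply Cexp_neq_0.
  rewrite Cmult_assoc, H. ring.
Qed.

(** * Derivatives along paths and complex derivatives *)

Lemma continuous_C_pair {T : UniformSpace} (f : T -> C) (x : T) :
  continuous (fun y => Re (f y)) x -> continuous (fun y => Im (f y)) x ->
  Ccontinuous f x.
Proof.
  intros H1 H2. apply filterlim_locally. intros eps.
  generalize (proj1 (filterlim_locally _ _) H1 eps)
             (proj1 (filterlim_locally _ _) H2 eps).
  intros A B. generalize (filter_and _ _ A B). apply filter_imp.
  intros y [? ?]; split; assumption.
Qed.

Lemma continuous_Re {T : UniformSpace} (f : T -> C) (x : T) :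
  Ccontinuous f x -> continuous (fun y => Re (f y)) x.
Proof.
  intros H. apply filterlim_locally. intros eps.
  generalize (proj1 (filterlim_locally _ _) H eps).
  apply filter_imp. intros y [? ?]; assumption.
Qed.

Lemma continuous_Im {T : UniformSpace} (f : T -> C) (x : T) :
  Ccontinuous f x -> continuous (fun y => Im (f y)) x.
Proof.
  intros H. apply filterlim_locally. intros eps.
  generalize (proj1 (filterlim_locally _ _) H eps).
  apply filter_imp. intros y [? ?]; assumption.
Qed.

Lemma continuous_Cplus {T : UniformSpace} (f g : T -> C) (x : T) :
  Ccontinuous f x -> Ccontinuous g x -> Ccontinuous (fun y => (f y + g y)%C) x.
Proof.
  intros Hf Hg. apply continuous_C_pair.
  - apply (continuous_plus (V := R_NormedModule)); now apply continuous_Re.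
  - apply (continuous_plus (V := R_NormedModule)); now apply continuous_Im.
Qed.

Lemma continuous_Cmult {T : UniformSpace} (f g : T -> C) (x : T) :
  Ccontinuous f x -> Ccontinuous g x -> Ccontinuous (fun y => (f y * g y)%C) x.
Proof.
  intros Hf Hg.
  assert (F1 := continuous_Re _ _ Hf). assert (F2 := continuous_Im _ _ Hf).
  assert (G1 := continuous_Re _ _ Hg). assert (G2 := continuous_Im _ _ Hg).
  apply continuous_C_pair.
  - apply (continuous_minus (V := R_NormedModule));
      apply (continuous_mult (K := R_AbsRing)); assumption.
  - apply (continuous_plus (V := R_NormedModule));
      apply (continuous_mult (K := R_AbsRing)); assumption.
Qed.

Lemma path_derive_pair (f : R -> C) (s : R) (l : C) :
  is_derive (fun x => Re (f x)) s (Re l) ->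
  is_derive (fun x => Im (f x)) s (Im l) -> path_derive f s l.
Proof.
  intros H1 H2.
  assert (K1 := is_derive_scal_l (V := C_R_NormedModule) _ s _ (RtoC 1) H1).
  assert (K2 := is_derive_scal_l (V := C_R_NormedModule) _ s _ Ci H2).
  generalize (is_derive_plus _ _ _ _ _ K1 K2).
  intros K. eapply is_derive_ext with (2 := eq_rect _ (fun v => is_derive _ s v) K _ _).
  - intros t. apply C_eq; simpl; unfold plus, scal; simpl; unfold mult; simpl; ring.
  Unshelve.
  apply C_eq; simpl; unfold plus, scal; simpl; unfold mult; simpl; ring.
Qed.

Lemma path_derive_Re (f : R -> C) (s : R) (l : C) :
  path_derive f s l -> is_derive (fun x => Re (f x)) s (Re l).
Proof.
  intros H.
  assert (L : is_linear (U := C_R_NormedModule) (V := R_NormedModule) fst)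
    by apply is_linear_fst.
  generalize (filterdiff_comp' f fst s _ _ H (filterdiff_linear _ L)).
  intros K. eapply filterdiff_ext_lin; [exact K | intros y; reflexivity].
Qed.

Lemma path_derive_Im (f : R -> C) (s : R) (l : C) :
  path_derive f s l -> is_derive (fun x => Im (f x)) s (Im l).
Proof.
  intros H.
  assert (L : is_linear (U := C_R_NormedModule) (V := R_NormedModule) snd)
    by apply is_linear_snd.
  generalize (filterdiff_comp' f snd s _ _ H (filterdiff_linear _ L)).
  intros K. eapply filterdiff_ext_lin; [exact K | intros y; reflexivity].
Qed.

Lemma path_derive_continuous (f : R -> C) (s : R) (l : C) :
  path_derive f s l -> Ccontinuous f s.
Proof.
  intros H. apply (ex_derive_continuous (V := C_R_NormedModule) f s).
  exists l; exact H.
Qed.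

(** The balls of the product structure on [C] are squares; this passes to
    discs. *)
Lemma locally_C_Cmod (z : C) (P : C -> Prop) :
  locally (T := C_UniformSpace) z P <->
  exists d : posreal, forall w, Cmod (w - z) < d -> P w.
Proof.
  split.
  - intros H. destruct (locally_norm_le_locally (V := C_NormedModule) z P H) as [d Hd].
    exists d. intros w Hw. apply Hd. exact Hw.
  - intros [d H]. apply (locally_le_locally_norm (V := C_NormedModule) z P).
    exists d. intros w Hw. apply H. exact Hw.
Qed.

Lemma hol_derive_eps (f : C -> C) (z l : C) :
  hol_derive f z l <->
  forall eps : posreal, exists d : posreal, forall w, Cmod (w - z) < d ->
    Cmod (f w - f z - l * (w - z)) <= eps * Cmod (w - z).
Proof.
  split.
  - intros [_ H] eps.
    specialize (H z (fun P HP => HP) eps).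
    apply (proj2 (locally_C z _)) in H.
    apply locally_C_Cmod in H. destruct H as [d H]. exists d. intros w Hw.
    specialize (H w Hw).
    rewrite (Cmult_comm l). exact H.
  - intros H. split.
    + apply is_linear_scal_l.
    + intros x Hx eps.
      assert (E : z = x)
        by exact (is_filter_lim_locally_unique
                    (V := AbsRing_NormedModule C_AbsRing) _ _ Hx).
      subst x.
      apply (proj1 (locally_C z _)). apply locally_C_Cmod.
      destruct (H eps) as [d Hd]. exists d. intros w Hw.
      specialize (Hd w Hw). rewrite (Cmult_comm l) in Hd. exact Hd.
Qed.

Lemma path_derive_eps (f : R -> C) (s : R) (l : C) :
  path_derive f s l <->
  forall eps : posreal, exists d : posreal, forall x, Rabs (x - s) < d ->
    Cmod (f x - f s - l * RtoC (x - s)) <= eps * Rabs (x - s).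
Proof.
  assert (E : forall x, minus (minus (f x) (f s))
     (scal (V := C_R_NormedModule) (minus x s : R_AbsRing) l)
     = (f x - f s - l * RtoC (x - s))%C).
  { intros x. apply C_eq; unfold scal, minus, plus, opp; simpl;
    unfold mult, scal, plus, opp; simpl; unfold mult; simpl; ring. }
  split.
  - intros [_ H] eps.
    specialize (H s (fun P HP => HP) eps). destruct H as [d H].
    exists d. intros x Hx. specialize (H x Hx).
    rewrite <- E, Cmod_norm. exact H.
  - intros H. split.
    + apply is_linear_scal_l.
    + intros x Hx eps.
      assert (Es : s = x)
        by exact (is_filter_lim_locally_unique
                    (V := AbsRing_NormedModule R_AbsRing) _ _ Hx).
      subst x.
      destruct (H eps) as [d Hd]. exists d. intros y Hy.
      specialize (Hd y Hy). rewrite <- E, Cmod_norm in Hd. exact Hd.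
Qed.

Lemma hol_derive_continuous (f : C -> C) (z l : C) :
  hol_derive f z l -> CCcontinuous f z.
Proof.
  intros H. apply filterlim_locally. intros eps.
  assert (K := ex_derive_continuous (V := C_NormedModule) f z (ex_intro _ l H)).
  apply (proj2 (locally_C z _)).
  apply (proj1 (filterlim_locally _ _) K eps).
Qed.

(** The uniform structures on [C] as a product and as a valued field have the
    same neighbourhoods but are distinct objects; locality is expressed with the
    former throughout. *)
Lemma hol_derive_ext_loc (f g : C -> C) (z l : C) :
  locally (T := C_UniformSpace) z (fun w => f w = g w) ->
  hol_derive f z l -> hol_derive g z l.
Proof.
  intros H. apply is_derive_ext_loc. apply (proj1 (locally_C z _)). exact H.
Qed.

Lemma Cmod_posreal_bound (l : C) : exists M : posreal, Cmod l <= M.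
Proof.
  assert (0 < Cmod l + 1) by (generalize (Cmod_ge_0 l); lra).
  exists (mkposreal _ H). simpl; lra.
Qed.

Lemma path_derive_comp (f : C -> C) (p : R -> C) (s : R) (l l' : C) :
  hol_derive f (p s) l -> path_derive p s l' ->
  path_derive (fun x => f (p x)) s (l * l')%C.
Proof.
  intros Hf Hp. apply path_derive_eps. intros eps.
  destruct (Cmod_posreal_bound l') as [M HM].
  destruct (Cmod_posreal_bound l) as [N HN].
  assert (He1 : 0 < eps / (2 * (M + 1))).
  { apply Rdiv_lt_0_compat; [apply cond_pos |]. generalize (cond_pos M); lra. }
  assert (He2 : 0 < Rmin 1 (eps / (2 * N))).
  { apply Rmin_pos; [lra |]. apply Rdiv_lt_0_compat; [apply cond_pos |].
    generalize (cond_pos N); lra. }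
  destruct (proj1 (hol_derive_eps _ _ _) Hf (mkposreal _ He1)) as [d1 H1].
  destruct (proj1 (path_derive_eps _ _ _) Hp (mkposreal _ He2)) as [d2 H2].
  cbn [pos] in H1, H2.
  assert (Hd : 0 < Rmin d2 (d1 / (M + 1))).
  { apply Rmin_pos; [apply cond_pos |].
    apply Rdiv_lt_0_compat; [apply cond_pos |]. generalize (cond_pos M); lra. }
  exists (mkposreal _ Hd). cbn [pos]. intros x Hx.
  assert (Hx2 : Rabs (x - s) < d2) by (eapply Rlt_le_trans; [exact Hx | apply Rmin_l]).
  assert (Hx1 : Rabs (x - s) < d1 / (M + 1))
    by (eapply Rlt_le_trans; [exact Hx | apply Rmin_r]).
  specialize (H2 x Hx2).
  assert (HR : Rmin 1 (eps / (2 * N)) <= 1) by apply Rmin_l.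
  assert (HR2 : Rmin 1 (eps / (2 * N)) <= eps / (2 * N)) by apply Rmin_r.
  assert (Pos := Rabs_pos (x - s)).
  assert (Hpx : Cmod (p x - p s) <= (M + 1) * Rabs (x - s)).
  { replace (p x - p s)%C with ((p x - p s - l' * RtoC (x - s)) + l' * RtoC (x - s))%C
      by ring.
    eapply Rle_trans; [apply Cmod_triangle |].
    rewrite Cmod_mult, Cmod_R. nra. }
  assert (Hlt : Cmod (p x - p s) < d1).
  { eapply Rle_lt_trans; [exact Hpx |].
    apply Rlt_le_trans with ((M + 1) * (d1 / (M + 1))).
    - apply Rmult_lt_compat_l; [generalize (cond_pos M); lra | exact Hx1].
    - right. field. generalize (cond_pos M); lra. }
  specialize (H1 _ Hlt).
  replace (f (p x) - f (p s) - l * l' * RtoC (x - s))%C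
    with ((f (p x) - f (p s) - l * (p x - p s)) +
          l * (p x - p s - l' * RtoC (x - s)))%C by ring.
  eapply Rle_trans; [apply Cmod_triangle |].
  rewrite (Cmod_mult l).
  assert (T1 : eps / (2 * (M + 1)) * Cmod (p x - p s) <= eps / 2 * Rabs (x - s)).
  { replace (eps / 2 * Rabs (x - s))
      with (eps / (2 * (M + 1)) * ((M + 1) * Rabs (x - s)))
      by (field; generalize (cond_pos M); lra).
    apply Rmult_le_compat_l; [lra | exact Hpx]. }
  assert (T2 : Cmod l * Cmod (p x - p s - l' * RtoC (x - s))
               <= eps / 2 * Rabs (x - s)).
  { replace (eps / 2 * Rabs (x - s))
      with (N * (eps / (2 * N) * Rabs (x - s)))
      by (field; generalize (cond_pos N); lra).
    apply Rmult_le_compat; try apply Cmod_ge_0; [exact HN |].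
    eapply Rle_trans; [exact H2 |].
    apply Rmult_le_compat_r; [apply Rabs_pos | exact HR2]. }
  lra.
Qed.

Lemma path_derive_mult (f g : R -> C) (s : R) (l m : C) :
  path_derive f s l -> path_derive g s m ->
  path_derive (fun x => (f x * g x)%C) s (l * g s + f s * m)%C.
Proof.
  intros Hf Hg.
  assert (F1 := path_derive_Re _ _ _ Hf). assert (F2 := path_derive_Im _ _ _ Hf).
  assert (G1 := path_derive_Re _ _ _ Hg). assert (G2 := path_derive_Im _ _ _ Hg).
  apply path_derive_pair.
  - evar_last.
    { apply (is_derive_minus (V := R_NormedModule));
      apply (is_derive_mult (K := R_AbsRing)); try eassumption; apply Rmult_comm. }
    unfold minus, plus, opp, mult; simpl; unfold Re, Im; ring.
  - evar_last.
    { apply (is_derive_plus (V := R_NormedModule));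
      apply (is_derive_mult (K := R_AbsRing)); try eassumption; apply Rmult_comm. }
    unfold minus, plus, opp, mult; simpl; unfold Re, Im; ring.
Qed.

Lemma path_derive_affine (p q : C) (s : R) :
  path_derive (fun x => (p + q * RtoC x)%C) s q.
Proof.
  apply path_derive_pair; simpl; auto_derive; auto; unfold Re, Im; ring.
Qed.

(** Projecting the increment of the path on its own direction reduces the
    inequality to the mean value theorem for one real function. *)
Lemma path_mean_value (f f' : R -> C) (M : R) :
  (forall s, 0 <= s <= 1 -> path_derive f s (f' s) /\ Cmod (f' s) <= M) ->
  Cmod (f 1 - f 0) <= M.
Proof.
  intros H. set (v := (f 1 - f 0)%C).
  destruct (Req_dec (Cmod v) 0) as [E | E].
  { rewrite E. destruct (H 0 ltac:(lra)) as [_ H0].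
    generalize (Cmod_ge_0 (f' 0)); lra. }
  assert (D : forall (w : C) (g : R -> C) s l, path_derive g s l ->
    is_derive (fun x => Re (Cconj w * g x)%C) s (Re (Cconj w * l)%C)).
  { intros w g s l Hg.
    apply (path_derive_Re (fun x => (Cconj w * g x)%C)).
    evar_last.
    - apply (path_derive_mult (fun _ => Cconj w)); [| exact Hg].
      apply (is_derive_const (V := C_R_NormedModule) (Cconj w) s).
    - change (zero : C_R_NormedModule) with (RtoC 0). ring. }
  destruct (MVT_gen (fun x => Re (Cconj v * f x)%C) 0 1
              (fun x => Re (Cconj v * f' x)%C)) as [c [Hc Ec]].
  - intros x. rewrite Rmin_left, Rmax_right by lra. intros Hx.
    apply D, H. lra.
  - intros x. rewrite Rmin_left, Rmax_right by lra. intros Hx.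
    apply continuity_pt_filterlim.
    apply (ex_derive_continuous (V := R_NormedModule)).
    eexists. apply D, H. lra.
  - rewrite Rmin_left, Rmax_right in Hc by lra.
    assert (E2 : Re (Cconj v * f 1)%C - Re (Cconj v * f 0)%C = Cmod v ^ 2).
    { rewrite Cmod2_alt. unfold v; simpl; unfold Re, Im; simpl; ring. }
    cbv beta in Ec. rewrite E2 in Ec.
    assert (Hle := Re_le_Cmod (Cconj v * f' c)%C).
    rewrite Cmod_mult, Cmod_conj in Hle.
    destruct (H c Hc) as [_ Hb].
    generalize (Cmod_ge_0 v). intros P.
    assert (0 < Cmod v) by lra.
    nra.
Qed.

(** The mean value inequality on the segment from [z] to [w] bounds the Taylor
    remainder by the oscillation of [f']. This turns the differentiation of real
    functions of one variable into complex differentiability. *)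
Lemma hol_derive_of_segments (f f' : C -> C) (z : C) :
  CCcontinuous f' z ->
  locally (T := C_UniformSpace) z (fun w => forall s, 0 <= s <= 1 ->
    path_derive (fun x => f (z + (w - z) * RtoC x)%C) s
      (f' (z + (w - z) * RtoC s) * (w - z))%C) ->
  hol_derive f z (f' z).
Proof.
  intros Hc Hl. apply hol_derive_eps. intros eps.
  apply locally_C_Cmod in Hl. destruct Hl as [d1 H1].
  assert (Hc' : locally (T := C_UniformSpace) z (fun w => Cmod (f' w - f' z) < eps)).
  { apply (Hc (fun v => Cmod (v - f' z) < eps)). apply locally_C_Cmod.
    exists eps. auto. }
  apply locally_C_Cmod in Hc'. destruct Hc' as [d2 H2].
  assert (Hd : 0 < Rmin d1 d2) by (apply Rmin_pos; apply cond_pos).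
  exists (mkposreal _ Hd). cbn [pos]. intros w Hw.
  assert (Hw1 : Cmod (w - z) < d1) by (eapply Rlt_le_trans; [exact Hw | apply Rmin_l]).
  assert (Hw2 : Cmod (w - z) < d2) by (eapply Rlt_le_trans; [exact Hw | apply Rmin_r]).
  specialize (H1 w Hw1).
  set (g := fun x : R => (f (z + (w - z) * RtoC x) + (- (f' z * (w - z))) * RtoC x)%C).
  replace (f w - f z - f' z * (w - z))%C with (g 1 - g 0)%C.
  2:{ unfold g. replace (z + (w - z) * RtoC 1)%C with w by ring.
      replace (z + (w - z) * RtoC 0)%C with z by ring. ring. }
  apply (path_mean_value g
    (fun s => (f' (z + (w - z) * RtoC s) * (w - z) + - (f' z * (w - z)))%C)).
  intros s Hs. split.
  - apply (is_derive_plus (V := C_R_NormedModule)); [apply H1, Hs |].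
    eapply is_derive_ext; [| apply (path_derive_affine 0 (- (f' z * (w - z)))%C s)].
    intros t; apply Cplus_0_l.
  - replace (f' (z + (w - z) * RtoC s) * (w - z) + - (f' z * (w - z)))%C
      with ((f' (z + (w - z) * RtoC s) - f' z) * (w - z))%C by ring.
    rewrite Cmod_mult. apply Rmult_le_compat_r; [apply Cmod_ge_0 |].
    apply Rlt_le, H2.
    replace (z + (w - z) * RtoC s - z)%C with ((w - z) * RtoC s)%C by ring.
    rewrite Cmod_mult, Cmod_R, Rabs_pos_eq by lra.
    generalize (Cmod_ge_0 (w - z)). nra.
Qed.

Lemma hol_derive_Cexp (z : C) : hol_derive Cexp z (Cexp z).
Proof.
  apply hol_derive_of_segments.
  - apply continuous_C_pair; unfold Cexp; simpl;
    apply (continuous_mult (K := R_AbsRing)).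
    + apply (continuous_comp (fun y : C => fst y) exp).
      * destruct z; apply continuous_fst.
      * apply continuous_exp.
    + apply (continuous_comp (fun y : C => snd y) cos).
      * destruct z; apply continuous_snd.
      * apply continuous_cos.
    + apply (continuous_comp (fun y : C => fst y) exp).
      * destruct z; apply continuous_fst.
      * apply continuous_exp.
    + apply (continuous_comp (fun y : C => snd y) sin).
      * destruct z; apply continuous_snd.
      * apply continuous_sin.
  - apply filter_forall. intros w s _. apply path_derive_pair.
    + unfold Cexp; simpl. auto_derive; auto. unfold Re, Im, Rminus; simpl.
      unfold Rminus; ring.
    + unfold Cexp; simpl. auto_derive; auto. unfold Re, Im, Rminus; simpl.
      unfold Rminus; ring.
Qed.

(** * The logarithm and its continuations *)

Definition off_negative_axis (t : C) : Prop := 0 < Re t \/ Im t <> 0.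

(** The domain on which [Clog_cont s] is holomorphic. *)
Definition cut_plane (s : contour) (t : C) : Prop :=
  match s with
  | Gamma_plus => Re t <> 0 \/ 0 < Im t
  | Gamma_minus => Re t <> 0 \/ Im t < 0
  end.

Lemma off_negative_axis_open (t : C) :
  off_negative_axis t ->
  exists d : posreal, forall w, Cmod (w - t) < d -> off_negative_axis w.
Proof.
  intros [H | H].
  - exists (mkposreal _ H). simpl. intros w Hw. left.
    generalize (re_le_Cmod (w - t)%C). intros K.
    apply Rabs_le_between in K. simpl in K. unfold Re in *. lra.
  - exists (mkposreal _ (Rabs_pos_lt _ H)). simpl. intros w Hw. right.
    generalize (Cmod_Im_le (w - t)%C). intros K E.
    simpl in K. unfold Im in *. rewrite E in K.
    replace (0 + - snd t) with (- snd t) in K by ring.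
    rewrite Rabs_Ropp in K. lra.
Qed.

Lemma off_negative_axis_neq_0 (t : C) : off_negative_axis t -> t <> 0%C.
Proof. intros [H | H] E; subst t; simpl in H; lra. Qed.

Lemma cut_plane_neq_0 (s : contour) (t : C) : cut_plane s t -> t <> 0%C.
Proof. destruct s; intros [H | H] E; subst t; simpl in H; lra. Qed.

Lemma Arg_bound (t : C) : Rabs (Arg t) <= PI.
Proof.
  unfold Arg. generalize (acos_bound (Re t / Cmod t)). intros H.
  destruct Rlt_dec; apply Rabs_le; lra.
Qed.

Lemma Arg_unique (t : C) (theta : R) :
  t <> 0%C -> - PI < theta <= PI ->
  Re t = Cmod t * cos theta -> Im t = Cmod t * sin theta -> Arg t = theta.
Proof.
  intros Ht Hth Hc Hs. apply Cmod_gt_0 in Ht.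
  assert (E : Re t / Cmod t = cos theta) by (rewrite Hc; field; lra).
  unfold Arg. rewrite E. destruct Rlt_dec as [Hl | Hl].
  - assert (theta < 0).
    { destruct (Rlt_le_dec theta 0) as [|K]; [assumption |].
      generalize (sin_ge_0 theta K (proj2 Hth)). nra. }
    rewrite <- cos_neg, acos_cos by lra. ring.
  - assert (0 <= theta).
    { destruct (Rle_lt_dec 0 theta) as [|K]; [assumption |].
      assert (0 < sin (- theta)) by (apply sin_gt_0; lra).
      rewrite sin_neg in H. nra. }
    apply acos_cos; lra.
Qed.

Lemma Cmod_sqr (t : C) : Cmod t * Cmod t = Re t * Re t + Im t * Im t.
Proof. generalize (Cmod2_alt t). intros H. nra. Qed.

Lemma off_negative_axis_denom (t : C) :
  off_negative_axis t -> 0 < Cmod t + Re t.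
Proof.
  intros H. assert (K := Cmod_sqr t). assert (P := Cmod_ge_0 t).
  destruct H as [H | H]; [lra |].
  assert (0 < Im t * Im t) by (apply Rsqr_pos_lt in H; exact H).
  nra.
Qed.

(** The half-angle formula describes the principal argument by a single
    expression on the whole slit plane, which makes it easy to differentiate. *)
Lemma Arg_half_angle (t : C) :
  off_negative_axis t -> Arg t = 2 * atan (Im t / (Cmod t + Re t)).
Proof.
  intros H.
  assert (Hd := off_negative_axis_denom t H).
  assert (H0 := off_negative_axis_neq_0 t H).
  assert (K := Cmod_sqr t).
  assert (Hp : 0 < Cmod t) by (apply Cmod_gt_0; exact H0).
  set (k := Im t / (Cmod t + Re t)).
  assert (B := atan_bound k).
  assert (Q : 0 < 1 + Rsqr k) by (generalize (Rle_0_sqr k); lra).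
  assert (Q2 : Cmod t * Cmod t = Re t ^ 2 + Im t ^ 2) by (simpl; lra).
  assert (Ck : cos (atan k) ^ 2 = / (1 + Rsqr k)).
  { rewrite cos_atan. unfold Rdiv. rewrite Rmult_1_l, pow_inv.
    rewrite pow2_sqrt by lra. reflexivity. }
  assert (Sk : sin (atan k) = k * cos (atan k)).
  { rewrite sin_atan, cos_atan. unfold Rdiv; ring. }
  assert (N : (Cmod t + Re t) ^ 2 + Im t ^ 2 = 2 * Cmod t * (Cmod t + Re t)) by nra.
  assert (V : 1 + Rsqr k = 2 * Cmod t / (Cmod t + Re t)).
  { unfold k, Rsqr. apply Rmult_eq_reg_r with ((Cmod t + Re t) ^ 2);
    [| apply pow_nonzero; lra].
    transitivity ((Cmod t + Re t) ^ 2 + Im t ^ 2); [field; lra |].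
    rewrite N. field. lra. }
  apply Arg_unique; [exact H0 | lra | |].
  - rewrite cos_2a, Sk.
    replace (cos (atan k) * cos (atan k) - k * cos (atan k) * (k * cos (atan k)))
      with ((2 - (1 + Rsqr k)) * cos (atan k) ^ 2) by (unfold Rsqr; ring).
    rewrite Ck, V. field. lra.
  - rewrite sin_2a, Sk.
    replace (2 * (k * cos (atan k)) * cos (atan k))
      with (2 * k * cos (atan k) ^ 2) by ring.
    rewrite Ck, V. unfold k. field. lra.
Qed.

Lemma continuous_fst_C (t : C) : continuous (T := C_UniformSpace) (fun w : C => fst w) t.
Proof. destruct t; apply continuous_fst. Qed.

Lemma continuous_snd_C (t : C) : continuous (T := C_UniformSpace) (fun w : C => snd w) t.
Proof. destruct t; apply continuous_snd. Qed.

Lemma continuous_Cinv (t : C) : t <> 0%C -> CCcontinuous Cinv t.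
Proof.
  intros Ht.
  assert (Hp : fst t ^ 2 + snd t ^ 2 <> 0).
  { intros E. apply Ht. apply Cmod_eq_0. unfold Cmod. rewrite E. apply sqrt_0. }
  assert (Hc : continuous (T := C_UniformSpace)
                 (fun w : C => / (fst w ^ 2 + snd w ^ 2)) t).
  { apply (continuous_comp (fun w : C => fst w ^ 2 + snd w ^ 2) Rinv).
    - apply (continuous_plus (V := R_NormedModule));
      apply (continuous_mult (K := R_AbsRing)).
      + apply continuous_fst_C.
      + apply (continuous_mult (K := R_AbsRing)); [apply continuous_fst_C |].
        apply continuous_const.
      + apply continuous_snd_C.
      + apply (continuous_mult (K := R_AbsRing)); [apply continuous_snd_C |].
        apply continuous_const.
    - apply continuous_Rinv; exact Hp. }
  apply continuous_C_pair; simpl; unfold Rdiv.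
  - apply (continuous_mult (K := R_AbsRing)); [apply continuous_fst_C | exact Hc].
  - apply (continuous_mult (K := R_AbsRing)); [| exact Hc].
    apply (continuous_opp (V := R_NormedModule)), continuous_snd_C.
Qed.

Lemma hol_derive_Clog (t : C) : off_negative_axis t -> hol_derive Clog t (/ t)%C.
Proof.
  intros Ht.
  apply (hol_derive_ext_loc
    (fun w => (ln (Cmod w), 2 * atan (Im w / (Cmod w + Re w))))).
  { apply locally_C_Cmod. destruct (off_negative_axis_open t Ht) as [d Hd].
    exists d. intros w Hw. unfold Clog. rewrite Arg_half_angle; auto. }
  apply (hol_derive_of_segments _ Cinv).
  { apply continuous_Cinv, off_negative_axis_neq_0, Ht. }
  apply locally_C_Cmod. destruct (off_negative_axis_open t Ht) as [d Hd].
  exists d. intros w Hw s Hs.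
  assert (Hz : off_negative_axis (t + (w - t) * RtoC s)%C).
  { apply Hd. replace (t + (w - t) * RtoC s - t)%C with ((w - t) * RtoC s)%C by ring.
    rewrite Cmod_mult, Cmod_R, Rabs_pos_eq by lra.
    generalize (Cmod_ge_0 (w - t)). nra. }
  set (h1 := Re (w - t)%C). set (h2 := Im (w - t)%C).
  assert (Eq : forall x, (t + (w - t) * RtoC x)%C = (Re t + h1 * x, Im t + h2 * x)).
  { intros x. apply C_eq; unfold h1, h2, Re, Im; simpl; ring. }
  rewrite Eq in Hz |- *.
  assert (H0 := off_negative_axis_neq_0 _ Hz).
  assert (Hd' := off_negative_axis_denom _ Hz).
  assert (K := Cmod_sqr (Re t + h1 * s, Im t + h2 * s)).
  apply Cmod_gt_0 in H0. unfold Cmod in Hd', K, H0. cbn [fst snd Re Im] in *.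
  set (x := Re t + h1 * s) in *. set (y := Im t + h2 * s) in *.
  assert (Hp : 0 < x ^ 2 + y ^ 2).
  { apply sqrt_lt_0_alt. rewrite sqrt_0. exact H0. }
  replace (w - t)%C with (h1, h2)
    by (unfold h1, h2; rewrite <- surjective_pairing; reflexivity).
  set (q := sqrt (x ^ 2 + y ^ 2)) in *.
  apply path_derive_pair.
  - apply is_derive_ext with
      (fun v => ln (sqrt ((Re t + h1 * v) ^ 2 + (Im t + h2 * v) ^ 2))).
    { intros v. rewrite Eq. reflexivity. }
    auto_derive; fold x y; change (x * (x * 1)) with (x ^ 2);
      change (y * (y * 1)) with (y ^ 2); fold q; [repeat split; auto |].
    simpl. replace (x * (x * 1) + y * (y * 1)) with (q * q) by lra.
    field. lra.
  - apply is_derive_ext with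
      (fun v => 2 * atan ((Im t + h2 * v) /
         (sqrt ((Re t + h1 * v) ^ 2 + (Im t + h2 * v) ^ 2) + (Re t + h1 * v)))).
    { intros v. rewrite Eq. reflexivity. }
    auto_derive; fold x y; change (x * (x * 1)) with (x ^ 2);
      change (y * (y * 1)) with (y ^ 2); fold q; [repeat split; auto; lra |].
    simpl. replace (x * (x * 1) + y * (y * 1)) with (q * q) by lra.
    assert (N : (q + x) ^ 2 + y ^ 2 = 2 * q * (q + x)) by nra.
    assert (M : h2 * (q + x) * q - y * (h1 * x + h2 * y + h1 * q)
                = (q + x) * (x * h2 - y * h1)).
    { replace (h2 * (q + x) * q) with (h2 * (q * q) + h2 * x * q) by ring.
      rewrite K. ring. }
    transitivity (2 * ((h2 * (q + x) * q - y * (h1 * x + h2 * y + h1 * q))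
                       / (q * ((q + x) ^ 2 + y ^ 2)))).
    + field. repeat split; try lra. nra.
    + rewrite M, N. field. lra.
Qed.

Lemma cut_plane_rotated (s : contour) (t : C) :
  cut_plane s t ->
  off_negative_axis (match s with Gamma_plus => (- Ci * t)%C
                                | Gamma_minus => (Ci * t)%C end).
Proof.
  unfold off_negative_axis; destruct s; intros [H | H]; simpl;
  unfold Re, Im in *; [right | left | right | left]; intros; lra.
Qed.

Lemma cut_plane_open (s : contour) (t : C) :
  cut_plane s t -> locally (T := C_UniformSpace) t (cut_plane s).
Proof.
  intros Ht. apply locally_C_Cmod.
  destruct (off_negative_axis_open _ (cut_plane_rotated s t Ht)) as [d Hd].
  exists d. intros w Hw.
  destruct s.
  - specialize (Hd (- Ci * w)%C).
    replace (- Ci * w - - Ci * t)%C with (- (Ci * (w - t)))%C in Hd by ring.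
    rewrite Cmod_opp, Cmod_mult, Cmod_Ci, Rmult_1_l in Hd.
    destruct (Hd Hw) as [K | K]; simpl in K; unfold cut_plane, Re, Im in *;
      [right | left]; intros; lra.
  - specialize (Hd (Ci * w)%C).
    replace (Ci * w - Ci * t)%C with (Ci * (w - t))%C in Hd by ring.
    rewrite Cmod_mult, Cmod_Ci, Rmult_1_l in Hd.
    destruct (Hd Hw) as [K | K]; simpl in K; unfold cut_plane, Re, Im in *;
      [right | left]; intros; lra.
Qed.

Lemma hol_derive_linear (c t : C) : hol_derive (fun w => (c * w)%C) t c.
Proof.
  apply hol_derive_eps. intros eps. exists (mkposreal 1 Rlt_0_1). intros w _.
  replace (c * w - c * t - c * (w - t))%C with (RtoC 0) by ring.
  rewrite Cmod_0. apply Rmult_le_pos; [apply Rlt_le, cond_pos | apply Cmod_ge_0].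
Qed.

Lemma hol_derive_const (c t : C) : hol_derive (fun _ => c) t (RtoC 0).
Proof. exact (is_derive_const (K := C_AbsRing) (V := C_NormedModule) c t). Qed.

(** The complex numbers as a module over themselves come in two versions, which
    have the same norm but distinct uniform structures. *)
Lemma hol_derive_AbsRing (f : C -> C) (t l : C) :
  hol_derive f t l <->
  is_derive (K := C_AbsRing) (V := AbsRing_NormedModule C_AbsRing) f t l.
Proof.
  split; intros [[A B D] H]; (split; [constructor; assumption | exact H]).
Qed.

Lemma hol_derive_id (t : C) : hol_derive (fun w => w) t (RtoC 1).
Proof. apply hol_derive_AbsRing. exact (is_derive_id (K := C_AbsRing) t). Qed.

Lemma hol_derive_plus (f g : C -> C) (t l m : C) :
  hol_derive f t l -> hol_derive g t m -> hol_derive (fun w => (f w + g w)%C) t (l + m)%C.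
Proof. exact (is_derive_plus (K := C_AbsRing) (V := C_NormedModule) f g t l m). Qed.

Lemma hol_derive_opp (f : C -> C) (t l : C) :
  hol_derive f t l -> hol_derive (fun w => (- f w)%C) t (- l)%C.
Proof. exact (is_derive_opp (K := C_AbsRing) (V := C_NormedModule) f t l). Qed.

Lemma hol_derive_minus (f g : C -> C) (t l m : C) :
  hol_derive f t l -> hol_derive g t m -> hol_derive (fun w => (f w - g w)%C) t (l - m)%C.
Proof. exact (is_derive_minus (K := C_AbsRing) (V := C_NormedModule) f g t l m). Qed.

Lemma hol_derive_mult (f g : C -> C) (t l m : C) :
  hol_derive f t l -> hol_derive g t m ->
  hol_derive (fun w => (f w * g w)%C) t (l * g t + f t * m)%C.
Proof.
  rewrite !hol_derive_AbsRing. intros Hf Hg.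
  exact (is_derive_mult (K := C_AbsRing) f g t l m Hf Hg Cmult_comm).
Qed.

Lemma hol_derive_comp (f g : C -> C) (t l m : C) :
  hol_derive f (g t) l -> hol_derive g t m ->
  hol_derive (fun w => f (g w)) t (m * l)%C.
Proof.
  intros Hf Hg. apply hol_derive_AbsRing in Hg.
  exact (is_derive_comp (K := C_AbsRing) (V := C_NormedModule) f g t l m Hf Hg).
Qed.

Lemma hol_derive_Clog_cont (s : contour) (t : C) :
  cut_plane s t -> hol_derive (Clog_cont s) t (/ t)%C.
Proof.
  intros Ht. assert (K := cut_plane_rotated s t Ht).
  assert (N := cut_plane_neq_0 s t Ht).
  assert (NC : Ci <> 0%C).
  { intros E. injection E. intros. lra. }
  destruct s; simpl.
  - evar_last.
    + apply hol_derive_plus; [| apply hol_derive_const].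
      apply (hol_derive_comp Clog (fun w => (- Ci * w)%C));
        [apply hol_derive_Clog, K | apply hol_derive_linear].
    + field. split; [exact N | exact NC].
  - evar_last.
    + apply hol_derive_minus; [| apply hol_derive_const].
      apply (hol_derive_comp Clog (fun w => (Ci * w)%C));
        [apply hol_derive_Clog, K | apply hol_derive_linear].
    + field. split; [exact N | exact NC].
Qed.

Lemma Ci_half_PI : (Ci * (PI / 2))%C = (0, PI / 2).
Proof. apply C_eq; unfold Re, Im; simpl; field. Qed.

Lemma Re_Clog_cont (s : contour) (t : C) : Re (Clog_cont s t) = ln (Cmod t).
Proof.
  destruct s; unfold Clog_cont; rewrite Ci_half_PI; unfold Clog, Re; cbn [fst snd Cplus Cminus Copp].
  - rewrite Cmod_mult, Cmod_opp, Cmod_Ci. unfold Re; simpl; rewrite Rmult_1_l; ring.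
  - rewrite Cmod_mult, Cmod_Ci. unfold Re; simpl; rewrite Rmult_1_l; ring.
Qed.

Lemma Im_Clog_cont (s : contour) (t : C) :
  Im (Clog_cont s t) = match s with
    | Gamma_plus => Arg (- Ci * t) + PI / 2
    | Gamma_minus => Arg (Ci * t) - PI / 2
    end.
Proof.
  destruct s; unfold Clog_cont; rewrite Ci_half_PI; reflexivity.
Qed.

Lemma Im_Clog_cont_bound (s : contour) (t : C) :
  Rabs (Im (Clog_cont s t)) <= 2 * PI.
Proof.
  assert (P := PI_RGT_0). rewrite Im_Clog_cont.
  destruct s.
  - generalize (Arg_bound (- Ci * t)%C). intros K. apply Rabs_le_between in K.
    apply Rabs_le. lra.
  - generalize (Arg_bound (Ci * t)%C). intros K. apply Rabs_le_between in K.
    apply Rabs_le. lra.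
Qed.

Lemma Arg_right_half_plane (t : C) :
  0 < Re t -> Rabs (Arg t) < PI / 2 /\
  Re t = Cmod t * cos (Arg t) /\ Im t = Cmod t * sin (Arg t).
Proof.
  intros H. assert (P := PI_RGT_0).
  assert (K := Cmod_sqr t). assert (Hp := Cmod_ge_0 t).
  assert (Hq : 0 < Cmod t) by nra.
  set (v := Re t / Cmod t).
  assert (Hv : 0 < v <= 1).
  { split; [apply Rdiv_lt_0_compat; assumption |].
    apply Rle_div_l; [assumption |].
    rewrite Rmult_1_l; apply Re_le_Cmod. }
  assert (Cv : cos (acos v) = v) by (apply cos_acos; lra).
  assert (Sv : Cmod t * sin (acos v) = Rabs (Im t)).
  { apply Rsqr_inj; [| apply Rabs_pos |].
    - apply Rmult_le_pos; [lra |]. rewrite sin_acos by lra. apply sqrt_pos.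
    - rewrite <- Rsqr_abs, Rsqr_mult, sin_acos, Rsqr_sqrt by (unfold Rsqr; nra).
      assert (E : Cmod t * v = Re t) by (unfold v; field; lra).
      unfold Rsqr. replace (Cmod t * Cmod t * (1 - v * v))
        with (Cmod t * Cmod t - (Cmod t * v) * (Cmod t * v)) by ring.
      rewrite E, K. ring. }
  assert (Ev : Re t = Cmod t * v) by (unfold v; field; lra).
  assert (Bv : 0 <= acos v < PI / 2).
  { destruct (acos_bound v) as [B1 B2]. split; [exact B1 |].
    destruct (Rlt_le_dec (acos v) (PI / 2)) as [| B3]; [assumption |].
    generalize (cos_le_0 (acos v)). lra. }
  unfold Arg. fold v. destruct Rlt_dec as [Hl | Hl].
  - rewrite Rabs_Ropp, cos_neg, sin_neg, Cv, Rabs_pos_eq by lra.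
    rewrite Rabs_left in Sv by lra. lra.
  - rewrite Cv, Rabs_pos_eq by lra. rewrite Rabs_pos_eq in Sv by lra. lra.
Qed.

(** A quarter turn brings the contour into the right half-plane, where the
    argument is less than [PI / 2] in absolute value; turning back does not leave
    the range of the principal argument. *)
Lemma Clog_cont_gamma (s : contour) (x : R) :
  Clog_cont s (gamma s x) = Clog (gamma s x).
Proof.
  assert (P := PI_RGT_0).
  assert (Hn : gamma s x <> 0%C).
  { intros E. destruct s; injection E; intros; lra. }
  apply C_eq.
  - rewrite Re_Clog_cont. reflexivity.
  - rewrite Im_Clog_cont. unfold Clog; cbn [Im snd]. symmetry.
    destruct s; simpl in *.
    + destruct (Arg_right_half_plane (- Ci * (x, 1))%C) as [A [B D]].
      { simpl; lra. }
      rewrite Cmod_mult, Cmod_opp, Cmod_Ci, Rmult_1_l in B, D.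
      simpl in B, D. apply Rabs_def2 in A.
      apply Arg_unique; [exact Hn | lra | |].
      * rewrite cos_plus, cos_PI2, sin_PI2. simpl. lra.
      * rewrite sin_plus, cos_PI2, sin_PI2. simpl. lra.
    + destruct (Arg_right_half_plane (Ci * (x, -1))%C) as [A [B D]].
      { simpl; lra. }
      rewrite Cmod_mult, Cmod_Ci, Rmult_1_l in B, D.
      simpl in B, D. apply Rabs_def2 in A.
      apply Arg_unique; [exact Hn | lra | |].
      * rewrite cos_minus, cos_PI2, sin_PI2. simpl. lra.
      * rewrite sin_minus, cos_PI2, sin_PI2. simpl. lra.
Qed.

(** * Integrals of complex functions over the real line *)

Local Notation path_int f a b := (RInt (V := C_R_CompleteNormedModule) f a b).
Local Notation is_line_int f l :=
  (is_RInt_gen (V := C_R_NormedModule) f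
     (Rbar_locally m_infty) (Rbar_locally p_infty) l).

Lemma is_path_int_continuous (f : R -> C) (a b : R) :
  (forall x, Ccontinuous f x) -> is_path_int f a b (path_int f a b).
Proof.
  intros H. apply (RInt_correct (V := C_R_CompleteNormedModule)).
  apply (ex_RInt_continuous (V := C_R_CompleteNormedModule)).
  intros x _. apply H.
Qed.

Lemma is_path_int_Cmult (c : C) (f : R -> C) (a b : R) (l : C) :
  is_path_int f a b l -> is_path_int (fun x => (c * f x)%C) a b (c * l)%C.
Proof.
  intros H.
  assert (H1 := is_RInt_fct_extend_fst (U := R_NormedModule) (V := R_NormedModule) _ _ _ _ H).
  assert (H2 := is_RInt_fct_extend_snd (U := R_NormedModule) (V := R_NormedModule) _ _ _ _ H).
  apply (is_RInt_fct_extend_pair (U := R_NormedModule) (V := R_NormedModule)).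
  - apply (is_RInt_minus (V := R_NormedModule));
      apply (is_RInt_scal (V := R_NormedModule)); assumption.
  - apply (is_RInt_plus (V := R_NormedModule));
      apply (is_RInt_scal (V := R_NormedModule)); assumption.
Qed.

Lemma filterlim_C_Cmult {T : Type} (F : (T -> Prop) -> Prop) (c : C) (f : T -> C) (l : C) :
  Filter F ->
  filterlim f F (locally (T := C_UniformSpace) l) ->
  filterlim (fun x => (c * f x)%C) F (locally (T := C_UniformSpace) (c * l)%C).
Proof.
  intros FF H. eapply filterlim_comp; [exact H |].
  apply (continuous_Cmult (T := C_UniformSpace) (fun _ => c) (fun y => y)).
  - apply continuous_const.
  - apply continuous_id.
Qed.

Lemma is_line_int_Cmult (c : C) (f : R -> C) (l : C) :
  is_line_int f l -> is_line_int (fun x => (c * f x)%C) (c * l)%C.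
Proof.
  intros H P HP.
  assert (K : locally (T := C_UniformSpace) l (fun y => P (c * y)%C)).
  { apply (filterlim_C_Cmult (locally (T := C_UniformSpace) l) c (fun y => y) l);
      [apply locally_filter | apply filterlim_id | exact HP]. }
  generalize (H _ K). unfold filtermapi. apply filter_imp.
  intros [a b] [y [Hy Py]]. exists (c * y)%C. split; [| exact Py].
  now apply is_path_int_Cmult.
Qed.

Lemma line_int_truncation (f : R -> C) (l : C) (p q : R -> R) :
  is_line_int f l ->
  filterlim p (Rbar_locally p_infty) (Rbar_locally m_infty) ->
  filterlim q (Rbar_locally p_infty) (Rbar_locally p_infty) ->
  filterlim (fun X => path_int f (p X) (q X)) (Rbar_locally p_infty)
    (locally (T := C_UniformSpace) l).
Proof.
  intros H Hp Hq P HP.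
  assert (K := filterlim_pair p q Hp Hq _ (H P HP)).
  unfold filtermap in *. revert K. apply filter_imp.
  intros X [y [Hy Py]].
  cbn [fst snd] in Hy.
  rewrite (is_RInt_unique (V := C_R_CompleteNormedModule) _ _ _ _ Hy). exact Py.
Qed.

Lemma Cmod_lim_le {T : Type} (F : (T -> Prop) -> Prop) (f : T -> C) (l : C) (B : R) :
  ProperFilter F ->
  filterlim f F (locally (T := C_UniformSpace) l) ->
  F (fun x => Cmod (f x) <= B) -> Cmod l <= B.
Proof.
  intros FF H HB. destruct (Rle_lt_dec (Cmod l) B) as [|Hl]; [assumption |].
  assert (He : 0 < Cmod l - B) by lra.
  assert (K : F (fun x => Cmod (f x - l) < Cmod l - B)).
  { apply (H (fun y => Cmod (y - l) < Cmod l - B)). apply locally_C_Cmod.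
    exists (mkposreal _ He). auto. }
  destruct (filter_ex _ (filter_and _ _ HB K)) as [x [H1 H2]].
  assert (E : Cmod l <= Cmod (f x) + Cmod (f x - l)).
  { replace l with (f x + - (f x - l))%C at 1 by ring.
    eapply Rle_trans; [apply Cmod_triangle |]. rewrite Cmod_opp. lra. }
  lra.
Qed.

Lemma path_int_norm_le (f : R -> C) (g G : R -> R) (a b : R) (l : C) :
  a <= b ->
  (forall x, a <= x <= b -> is_derive G x (g x)) ->
  (forall x, a <= x <= b -> continuous g x) ->
  (forall x, a <= x <= b -> Cmod (f x) <= g x) ->
  is_path_int f a b l -> Cmod l <= G b - G a.
Proof.
  intros Hab HG Hg Hb H. rewrite Cmod_norm.
  apply (norm_RInt_le (V := C_R_NormedModule) f g a b l); [exact Hab | | exact H |].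
  - intros x Hx. rewrite <- Cmod_norm. apply Hb, Hx.
  - apply (is_RInt_derive (V := R_CompleteNormedModule) G g);
      rewrite Rmin_left, Rmax_right by exact Hab; assumption.
Qed.

(** An exponential majorant, rather than a Gaussian one, has tails with an
    explicit integral. *)
Definition exp_dominated (M : R) (f : R -> C) : Prop :=
  forall x, Cmod (f x) <= M * exp (- Rabs x).

Lemma exp_dominated_nonneg (M : R) (f : R -> C) : exp_dominated M f -> 0 <= M.
Proof.
  intros H. specialize (H 0). rewrite Rabs_R0, Ropp_0, exp_0 in H.
  generalize (Cmod_ge_0 (f 0)). lra.
Qed.

Lemma exp_dominated_right_tail (M : R) (f : R -> C) (a b : R) (l : C) :
  exp_dominated M f -> 0 <= a <= b -> is_path_int f a b l ->
  Cmod l <= M * exp (- a).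
Proof.
  intros Hf Hab H. assert (HM := exp_dominated_nonneg _ _ Hf).
  apply Rle_trans with (- M * exp (- b) - (- M * exp (- a))).
  - apply (path_int_norm_le f (fun x => M * exp (- x)) (fun x => - M * exp (- x)));
      [lra | | | | exact H].
    + intros x _. auto_derive; [auto | ring].
    + intros x _. apply (ex_derive_continuous (V := R_NormedModule)).
      auto_derive; auto.
    + intros x Hx. generalize (Hf x). rewrite Rabs_pos_eq by lra. auto.
  - generalize (exp_pos (- b)). nra.
Qed.

Lemma exp_dominated_left_tail (M : R) (f : R -> C) (a b : R) (l : C) :
  exp_dominated M f -> a <= b <= 0 -> is_path_int f a b l ->
  Cmod l <= M * exp b.
Proof.
  intros Hf Hab H. assert (HM := exp_dominated_nonneg _ _ Hf).
  apply Rle_trans with (M * exp b - M * exp a).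
  - apply (path_int_norm_le f (fun x => M * exp x) (fun x => M * exp x));
      [lra | | | | exact H].
    + intros x _. auto_derive; [auto | ring].
    + intros x _. apply (ex_derive_continuous (V := R_NormedModule)).
      auto_derive; auto.
    + intros x Hx. generalize (Hf x). rewrite Rabs_left1, Ropp_involutive by lra. auto.
  - generalize (exp_pos a). nra.
Qed.

Lemma path_int_Chasles (f : R -> C) (a b c : R) :
  (forall x, Ccontinuous f x) ->
  (path_int f a b + path_int f b c)%C = path_int f a c.
Proof.
  intros H. apply (RInt_Chasles (V := C_R_CompleteNormedModule));
  eexists; apply is_path_int_continuous, H.
Qed.

Lemma path_int_increment (f : R -> C) (a b : R) :
  (forall x, Ccontinuous f x) ->
  (path_int f 0 b - path_int f 0 a)%C = path_int f a b.
Proof. intros H. rewrite <- (path_int_Chasles f 0 a b H). ring. Qed.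

Lemma exp_small (M eps : R) : 0 <= M -> 0 < eps ->
  exists A, 0 < A /\ M * exp (- A) < eps.
Proof.
  intros HM He. exists (Rmax 1 (M / eps)).
  assert (H1 := Rmax_l 1 (M / eps)). assert (H2 := Rmax_r 1 (M / eps)).
  set (A := Rmax 1 (M / eps)) in *. split; [lra |].
  rewrite exp_Ropp. assert (K := exp_ineq1 A ltac:(lra)).
  apply Rlt_div_l; [apply exp_pos |].
  apply Rle_lt_trans with (A * eps).
  - apply Rle_div_l; [exact He | exact H2].
  - rewrite Rmult_comm. apply Rmult_lt_compat_l; lra.
Qed.

Lemma ball_C_Cmod (x y : C) (eps : posreal) :
  Cmod (y - x) < eps -> ball (M := C_UniformSpace) x eps y.
Proof. apply C_NormedModule_mixin_compat1. Qed.

(** Convergence of the two tails is Cauchy's criterion, with the exponential as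
    a majorant that can be integrated explicitly. *)
Lemma exp_dominated_line_int (M : R) (f : R -> C) :
  (forall x, Ccontinuous f x) -> exp_dominated M f -> exists l, is_line_int f l.
Proof.
  intros Hc Hf. assert (HM := exp_dominated_nonneg _ _ Hf).
  set (F := fun x => path_int f 0 x).
  assert (Hright : forall a b, 0 < a -> 0 < b ->
             Cmod (F b - F a) <= M * exp (- Rmin a b)).
  { intros a b Ha Hb. unfold F.
    destruct (Rle_dec a b) as [Hab | Hab].
    - rewrite Rmin_left, path_int_increment by assumption.
      apply (exp_dominated_right_tail M f a b); [assumption | lra |].
      apply is_path_int_continuous, Hc.
    - rewrite Rmin_right, Cmod_minus_sym, path_int_increment by (assumption || lra).
      apply (exp_dominated_right_tail M f b a); [assumption | lra |].
      apply is_path_int_continuous, Hc. }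
  assert (Hleft : forall a b, a < 0 -> b < 0 ->
             Cmod (F b - F a) <= M * exp (Rmax a b)).
  { intros a b Ha Hb. unfold F.
    destruct (Rle_dec a b) as [Hab | Hab].
    - rewrite Rmax_right, path_int_increment by assumption.
      apply (exp_dominated_left_tail M f a b); [assumption | lra |].
      apply is_path_int_continuous, Hc.
    - rewrite Rmax_left, Cmod_minus_sym, path_int_increment by (assumption || lra).
      apply (exp_dominated_left_tail M f b a); [assumption | lra |].
      apply is_path_int_continuous, Hc. }
  assert (Lp : exists l, filterlim F (Rbar_locally p_infty) (locally (T := C_UniformSpace) l)).
  { apply (filterlim_locally_cauchy (U := C_R_CompleteNormedModule)).
    intros eps. destruct (exp_small M eps HM (cond_pos eps)) as [A [HA HAe]].
    exists (fun x => A < x). split; [exists A; auto |].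
    intros u v Hu Hv. apply ball_C_Cmod.
    eapply Rle_lt_trans; [apply Hright; lra |].
    eapply Rle_lt_trans; [| exact HAe]. apply Rmult_le_compat_l; [exact HM |].
    apply Rlt_le, exp_increasing. apply Ropp_lt_contravar. now apply Rmin_glb_lt. }
  assert (Lm : exists l, filterlim F (Rbar_locally m_infty) (locally (T := C_UniformSpace) l)).
  { apply (filterlim_locally_cauchy (U := C_R_CompleteNormedModule)).
    intros eps. destruct (exp_small M eps HM (cond_pos eps)) as [A [HA HAe]].
    exists (fun x => x < - A). split; [exists (- A); auto |].
    intros u v Hu Hv. apply ball_C_Cmod.
    eapply Rle_lt_trans; [apply Hleft; lra |].
    eapply Rle_lt_trans; [| exact HAe]. apply Rmult_le_compat_l; [exact HM |].
    apply Rlt_le, exp_increasing. now apply Rmax_lub_lt. }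
  destruct Lp as [lp Hlp], Lm as [lm Hlm].
  exists (lp - lm)%C.
  apply (filterlimi_lim_ext (fun ab => (F (snd ab) - F (fst ab))%C)).
  - intros [a b]. simpl. unfold F. rewrite path_int_increment by exact Hc.
    apply is_path_int_continuous, Hc.
  - apply (filterlim_comp_2 (G := locally (T := C_UniformSpace) lp)
             (H := locally (T := C_UniformSpace) lm)
             (fun ab : R * R => F (snd ab)) (fun ab => F (fst ab)) Cminus).
    + eapply filterlim_comp; [apply filterlim_snd | exact Hlp].
    + eapply filterlim_comp; [apply filterlim_fst | exact Hlm].
    + unfold Cminus.
      apply (filterlim_comp_2 (G := locally (T := C_UniformSpace) lp)
               (H := locally (T := C_UniformSpace) (- lm)%C)
               (fun ab : C * C => fst ab) (fun ab => Copp (snd ab)) Cplus).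
      * apply filterlim_fst.
      * eapply filterlim_comp; [apply filterlim_snd |].
        exact (filterlim_opp (V := C_R_NormedModule) lm).
      * exact (filterlim_plus (V := C_R_NormedModule) lp (- lm)%C).
Qed.

Lemma filterlim_Ropp_p_m :
  filterlim Ropp (Rbar_locally p_infty) (Rbar_locally m_infty).
Proof. intros P [A HA]. exists (- A). intros x Hx. apply HA. lra. Qed.

Lemma line_int_symmetric (f : R -> C) (l : C) :
  is_line_int f l ->
  filterlim (fun X => path_int f (- X) X) (Rbar_locally p_infty)
    (locally (T := C_UniformSpace) l).
Proof.
  intros H. apply (line_int_truncation f l Ropp (fun x => x)); [exact H | |].
  - apply filterlim_Ropp_p_m.
  - apply filterlim_id.
Qed.

Lemma exp_dominated_line_int_le (M : R) (f : R -> C) (l : C) :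
  (forall x, Ccontinuous f x) -> exp_dominated M f -> is_line_int f l ->
  Cmod l <= 2 * M.
Proof.
  intros Hc Hf Hl. assert (HM := exp_dominated_nonneg _ _ Hf).
  apply (Cmod_lim_le _ _ _ _ _ (line_int_symmetric f l Hl)).
  exists 0. intros X HX. rewrite <- (path_int_Chasles f _ 0 _ Hc).
  eapply Rle_trans; [apply Cmod_triangle |].
  assert (A1 : Cmod (path_int f (- X) 0) <= M * exp 0).
  { apply (exp_dominated_left_tail M f (- X) 0); [assumption | lra |].
    apply is_path_int_continuous, Hc. }
  assert (A2 : Cmod (path_int f 0 X) <= M * exp (- 0)).
  { apply (exp_dominated_right_tail M f 0 X); [assumption | lra |].
    apply is_path_int_continuous, Hc. }
  rewrite Ropp_0 in A2. rewrite exp_0 in A1, A2. lra.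
Qed.

Lemma cubic_gaussian_int_le (K D X : R) (f : R -> C) (l : C) :
  0 < D -> 0 <= X ->
  (forall u, Cmod (f u) <= K * (Rabs u ^ 3 * exp (- D * u ^ 2))) ->
  (forall x, Ccontinuous f x) ->
  is_path_int f (- X) X l -> Cmod l <= K / D ^ 2.
Proof.
  intros HD HX Hf Hc H.
  assert (HK : 0 <= K).
  { generalize (Hf 1) (Cmod_ge_0 (f 1)) (exp_pos (- D * 1 ^ 2)).
    rewrite Rabs_R1. nra. }
  (* Minus a primitive of [K * u ^ 3 * exp (- D * u ^ 2)]. *)
  set (G := fun u => K * ((u ^ 2 + / D) * exp (- D * u ^ 2)) / (2 * D)).
  assert (HG : forall u, is_derive G u (- (K * (u ^ 3 * exp (- D * u ^ 2))))).
  { intros u. unfold G. auto_derive; [auto |]. simpl. field. lra. }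
  assert (Hc3 : forall c u, continuous (fun u => c * (K * (u ^ 3 * exp (- D * u ^ 2)))) u).
  { intros c u. apply (ex_derive_continuous (V := R_NormedModule)).
    auto_derive; auto. }
  assert (G0 : G 0 = K / D ^ 2 / 2).
  { unfold G. replace (- D * 0 ^ 2) with 0 by ring. rewrite exp_0. field. lra. }
  assert (GX : 0 <= G X).
  { unfold G. apply Rmult_le_pos; [| apply Rlt_le, Rinv_0_lt_compat; lra].
    apply Rmult_le_pos; [exact HK |]. apply Rmult_le_pos; [| apply Rlt_le, exp_pos].
    generalize (Rinv_0_lt_compat D HD) (pow2_ge_0 X). lra. }
  assert (GmX : G (- X) = G X).
  { unfold G. replace ((- X) ^ 2) with (X ^ 2) by ring. reflexivity. }
  rewrite <- (is_RInt_unique (V := C_R_CompleteNormedModule) _ _ _ _ H).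
  rewrite <- (path_int_Chasles f _ 0 _ Hc).
  eapply Rle_trans; [apply Cmod_triangle |].
  assert (A1 : Cmod (path_int f (- X) 0) <= G 0 - G (- X)).
  { apply (path_int_norm_le f (fun u => -1 * (K * (u ^ 3 * exp (- D * u ^ 2)))) G);
      [lra | | intros; apply Hc3 | | apply is_path_int_continuous, Hc].
    - intros u _. evar_last; [apply HG | ring].
    - intros u Hu. eapply Rle_trans; [apply Hf |]. rewrite Rabs_left1 by lra.
      right; ring. }
  assert (A2 : Cmod (path_int f 0 X) <= - G X - - G 0).
  { apply (path_int_norm_le f (fun u => 1 * (K * (u ^ 3 * exp (- D * u ^ 2)))) (fun u => - G u));
      [lra | | intros; apply Hc3 | | apply is_path_int_continuous, Hc].
    - intros u _. evar_last; [apply (is_derive_opp (V := R_NormedModule)), HG |].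
      unfold opp; simpl; ring.
    - intros u Hu. eapply Rle_trans; [apply Hf |]. rewrite Rabs_pos_eq by lra.
      right; ring. }
  lra.
Qed.

(** * Deformation of contours *)

Definition segment (p0 p1 q0 q1 : C) (u v : R) : C :=
  (p0 + p1 * RtoC u + (q0 + q1 * RtoC u - (p0 + p1 * RtoC u)) * RtoC v)%C.

Lemma continuous_Copp {T : UniformSpace} (f : T -> C) (x : T) :
  Ccontinuous f x -> Ccontinuous (fun y => (- f y)%C) x.
Proof. exact (continuous_opp (V := C_R_NormedModule) f x). Qed.

Lemma continuous_RtoC {T : UniformSpace} (f : T -> R) (x : T) :
  continuous f x -> Ccontinuous (fun y => RtoC (f y)) x.
Proof.
  intros Hf. apply continuous_C_pair; [exact Hf | apply continuous_const].
Qed.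

Ltac solve_continuous_C :=
  lazymatch goal with
  | |- continuous (fun _ => ?c) _ => apply continuous_const
  | |- continuous (fun x => Cplus _ _) _ =>
      apply continuous_Cplus; solve_continuous_C
  | |- continuous (fun x => Cmult _ _) _ =>
      apply continuous_Cmult; solve_continuous_C
  | |- continuous (fun x => Copp _) _ =>
      apply continuous_Copp; solve_continuous_C
  | |- continuous (fun x => RtoC _) _ =>
      apply continuous_RtoC; solve_continuous_C
  | |- continuous Copp ?x => exact (continuous_opp (V := C_R_NormedModule) _ x (continuous_id x))
  | |- continuous (Cmult ?c) _ =>
      apply (continuous_Cmult (fun _ => c) (fun y => y));
      [apply continuous_const | apply continuous_id]
  | |- _ => first [assumption | apply continuous_id | apply continuous_fst
                  | apply continuous_snd]
  end.

Lemma continuous_segment (p0 p1 q0 q1 : C) (u v : R) :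
  Ccontinuous (fun w : R * R => segment p0 p1 q0 q1 (fst w) (snd w)) (u, v).
Proof.
  unfold segment, Cminus.
  solve_continuous_C.
Qed.

Section Homotopy.

Variables (S : C -> Prop) (G G' : C -> C) (p0 p1 q0 q1 : C).
Hypothesis S_open : forall t, S t -> locally (T := C_UniformSpace) t S.
Hypothesis G_derive : forall t, S t -> hol_derive G t (G' t).
Hypothesis G'_continuous : forall t, S t -> CCcontinuous G' t.
Hypothesis segment_S : forall u v, 0 <= v <= 1 -> S (segment p0 p1 q0 q1 u v).

Let p (u : R) : C := (p0 + p1 * RtoC u)%C.
Let q (u : R) : C := (q0 + q1 * RtoC u)%C.
Let zeta := segment p0 p1 q0 q1.
(** With [zeta_u] and [zeta_v] the partial derivatives of [zeta], the function
    [K] is the derivative of [G zeta * zeta_v] in [u], and equally that of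
    [G zeta * zeta_u] in [v]. *)
Let K (u v : R) : C :=
  (G' (zeta u v) * (p1 + (q1 - p1) * RtoC v) * (q u - p u)
   + G (zeta u v) * (q1 - p1))%C.

Lemma zeta_derive_u (u v : R) :
  path_derive (fun x => zeta x v) u (p1 + (q1 - p1) * RtoC v)%C.
Proof.
  eapply is_derive_ext; [| apply (path_derive_affine
    (p0 + (q0 - p0) * RtoC v)%C (p1 + (q1 - p1) * RtoC v)%C u)].
  intros t. unfold zeta, segment. apply (@eq_sym C). ring.
Qed.

Lemma zeta_derive_v (u v : R) :
  path_derive (fun x => zeta u x) v (q u - p u)%C.
Proof. apply (path_derive_affine (p u) (q u - p u)%C v). Qed.

Lemma homotopy_derive_u (u v : R) :
  S (zeta u v) ->
  path_derive (fun x => (G (zeta x v) * (q x - p x))%C) u (K u v).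
Proof.
  intros H. apply path_derive_mult with
    (f := fun x => G (zeta x v)) (g := fun x => (q x - p x)%C).
  - apply (path_derive_comp G); [apply G_derive, H | apply zeta_derive_u].
  - eapply is_derive_ext; [| apply (path_derive_affine (q0 - p0) (q1 - p1) u)].
    intros t. unfold p, q. apply (@eq_sym C). ring.
Qed.

Lemma homotopy_derive_v (u v : R) :
  S (zeta u v) ->
  path_derive (fun x => (G (zeta u x) * (p1 + (q1 - p1) * RtoC x))%C) v (K u v).
Proof.
  intros H.
  evar_last.
  - apply path_derive_mult with
      (f := fun x => G (zeta u x)) (g := fun x => (p1 + (q1 - p1) * RtoC x)%C).
    + apply (path_derive_comp G); [apply G_derive, H | apply zeta_derive_v].
    + apply path_derive_affine.
  - unfold K. apply (@eq_sym C). ring.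
Qed.

Lemma homotopy_K_continuous (u v : R) :
  S (zeta u v) -> Ccontinuous (fun w : R * R => K (fst w) (snd w)) (u, v).
Proof.
  intros H. assert (Hz := continuous_segment p0 p1 q0 q1 u v). fold zeta in Hz.
  assert (HG : Ccontinuous (fun w : R * R => G (zeta (fst w) (snd w))) (u, v)).
  { apply (continuous_comp (fun w : R * R => zeta (fst w) (snd w)) G (u, v) Hz).
    apply (hol_derive_continuous _ _ _ (G_derive _ H)). }
  assert (HG' : Ccontinuous (fun w : R * R => G' (zeta (fst w) (snd w))) (u, v)).
  { apply (continuous_comp (fun w : R * R => zeta (fst w) (snd w)) G' (u, v) Hz).
    apply (G'_continuous _ H). }
  unfold K, p, q, Cminus.
  solve_continuous_C.
Qed.

Lemma homotopy_K_int (u : R) :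
  is_path_int (K u) 0 1 (G (q u) * q1 - G (p u) * p1)%C.
Proof.
  evar_last.
  - apply (is_RInt_derive (V := C_R_CompleteNormedModule)
      (fun x => (G (zeta u x) * (p1 + (q1 - p1) * RtoC x))%C) (K u));
    rewrite Rmin_left, Rmax_right by lra; intros v Hv.
    + apply homotopy_derive_v, segment_S, Hv.
    + apply (continuous_comp_2 (fun _ : R => u) (fun x : R => x) K).
      * apply continuous_const.
      * apply continuous_id.
      * apply homotopy_K_continuous, segment_S, Hv.
  - change (G (zeta u 1) * (p1 + (q1 - p1) * 1)
            - G (zeta u 0) * (p1 + (q1 - p1) * 0) = G (q u) * q1 - G (p u) * p1)%C.
    replace (zeta u 1) with (q u) by (unfold zeta, segment, p, q; ring).
    replace (zeta u 0) with (p u) by (unfold zeta, segment, p, q; ring).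
    ring.
Qed.

Lemma homotopy_integrable (phi : C -> R) (u : R) :
  (forall T (f : UniformSpace.sort T -> C) x,
      Ccontinuous f x -> continuous (fun y => phi (f y)) x) ->
  ex_RInt (V := R_NormedModule)
    (fun v => phi (G (zeta u v) * (q u - p u))%C) 0 1.
Proof.
  intros Hphi. apply (ex_RInt_continuous (V := R_CompleteNormedModule)).
  rewrite Rmin_left, Rmax_right by lra. intros v Hv.
  apply (Hphi R_UniformSpace), continuous_Cmult; [| apply continuous_const].
  apply (continuous_comp (fun x : R => zeta u x) G).
  - apply (path_derive_continuous _ _ _ (zeta_derive_v u v)).
  - apply (hol_derive_continuous _ _ _ (G_derive _ (segment_S u v Hv))).
Qed.

(** The theorem on integrals depending on a variable concerns real functions;
    it is applied to the real and to the imaginary part, that is, for [phi] one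
    of [Re] and [Im]. *)
Lemma homotopy_int_derive (phi : C -> R) (u : R) :
  (forall T (f : UniformSpace.sort T -> C) x,
      Ccontinuous f x -> continuous (fun y => phi (f y)) x) ->
  (forall f x l, path_derive f x l -> is_derive (fun y => phi (f y)) x (phi l)) ->
  is_RInt (V := R_NormedModule) (fun v => phi (K u v)) 0 1
    (phi (G (q u) * q1 - G (p u) * p1)%C) ->
  is_derive
    (fun x => RInt (V := R_CompleteNormedModule)
       (fun v => phi (G (zeta x v) * (q x - p x))%C) 0 1) u
    (phi (G (q u) * q1 - G (p u) * p1)%C).
Proof.
  intros Hc Hd HI.
  assert (D : forall x v, S (zeta x v) ->
    is_derive (fun y => phi (G (zeta y v) * (q y - p y))%C) x (phi (K x v))).
  { intros x v H. apply (Hd (fun y => (G (zeta y v) * (q y - p y))%C)).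
    apply homotopy_derive_u, H. }
  evar_last.
  - apply (is_derive_RInt_param (fun x v => phi (G (zeta x v) * (q x - p x))%C) 0 1 u);
    rewrite ?Rmin_left, ?Rmax_right by lra.
    + apply filter_forall. intros x v Hv. eexists. apply D, segment_S, Hv.
    + intros v Hv.
      apply (continuity_2d_pt_ext_loc (fun x y => phi (K x y))).
      * apply locally_2d_locally.
        assert (HS : locally (u, v) (fun w => S (zeta (fst w) (snd w)))).
        { apply (continuous_segment p0 p1 q0 q1 u v S).
          apply S_open, segment_S, Hv. }
        revert HS. apply filter_imp. intros w Hw.
        symmetry. apply is_derive_unique, D, Hw.
      * apply continuity_2d_pt_filterlim.
        apply (Hc (prod_UniformSpace R_UniformSpace R_UniformSpace)
                 (fun w : R * R => K (fst w) (snd w)) (u, v)).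
        apply homotopy_K_continuous, segment_S, Hv.
    + apply filter_forall. intros x. apply homotopy_integrable, Hc.
  - apply is_RInt_unique. revert HI. apply is_RInt_ext.
    rewrite Rmin_left, Rmax_right by lra. intros v Hv.
    symmetry. apply is_derive_unique, D, segment_S. lra.
Qed.

(** Cauchy's theorem in differential form. The function [h] is the integral of
    [G] along the segment joining corresponding points of the two lines; since
    the mixed derivatives agree, differentiating in [u] under the integral leaves
    only the contributions of the two end points. *)
Lemma joining_segment_primitive :
  exists h : R -> C,
    (forall u, path_derive h u (G (q u) * q1 - G (p u) * p1)%C) /\
    (forall u B, (forall v, 0 <= v <= 1 -> Cmod (G (zeta u v)) <= B) ->
       Cmod (h u) <= B * Cmod (q u - p u)).
Proof.
  exists (fun u =>
    (RInt (V := R_CompleteNormedModule) (fun v => Re (G (zeta u v) * (q u - p u))%C) 0 1,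
     RInt (V := R_CompleteNormedModule) (fun v => Im (G (zeta u v) * (q u - p u))%C) 0 1)).
  split.
  - intros u. apply path_derive_pair.
    + apply (homotopy_int_derive Re).
      * intros T f x; apply continuous_Re.
      * intros f x l; apply path_derive_Re.
      * apply (is_RInt_fct_extend_fst (U := R_NormedModule) (V := R_NormedModule)).
        apply homotopy_K_int.
    + apply (homotopy_int_derive Im).
      * intros T f x; apply continuous_Im.
      * intros f x l; apply path_derive_Im.
      * apply (is_RInt_fct_extend_snd (U := R_NormedModule) (V := R_NormedModule)).
        apply homotopy_K_int.
  - intros u B HB.
    replace (B * Cmod (q u - p u))
      with ((fun x => B * Cmod (q u - p u) * x) 1 - (fun x => B * Cmod (q u - p u) * x) 0)
      by (cbv beta; ring).
    apply (path_int_norm_le (fun v => (G (zeta u v) * (q u - p u))%C)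
             (fun _ => B * Cmod (q u - p u))).
    + lra.
    + intros x _. auto_derive; [auto | ring].
    + intros x _. apply continuous_const.
    + intros x Hx. rewrite Cmod_mult.
      apply Rmult_le_compat_r; [apply Cmod_ge_0 | apply HB, Hx].
    + apply (is_RInt_fct_extend_pair (U := R_NormedModule) (V := R_NormedModule));
      apply (RInt_correct (V := R_CompleteNormedModule)).
      * apply (homotopy_integrable Re). intros T f x; apply continuous_Re.
      * apply (homotopy_integrable Im). intros T f x; apply continuous_Im.
Qed.

End Homotopy.

(** * The integrals over the horizontal contours *)

Lemma ln_le_self (x : R) : 0 < x -> ln x <= x.
Proof.
  intros H. destruct (Req_dec (ln x) 0) as [E | E]; [rewrite E; lra |].
  generalize (exp_ineq1 (ln x) E). rewrite exp_ln by exact H. lra.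
Qed.

Lemma Clog_cont_bound (s : contour) (t : C) :
  t <> 0%C -> Cmod (Clog_cont s t) <= Cmod t + / Cmod t + 2 * PI.
Proof.
  intros Ht. apply Cmod_gt_0 in Ht.
  eapply Rle_trans; [apply Cmod_le_ReIm |].
  apply Rplus_le_compat; [| apply Im_Clog_cont_bound].
  rewrite Re_Clog_cont. assert (Hi := Rinv_0_lt_compat _ Ht).
  apply Rabs_le. split.
  - generalize (ln_le_self _ Hi). rewrite ln_Rinv by exact Ht. lra.
  - generalize (ln_le_self _ Ht). lra.
Qed.

(** Outside the unit disc the logarithm is bounded by [Cmod t] up to a constant,
    so the exponent is governed by its quadratic term. *)
Lemma Re_phase_le (s : contour) (b w t : C) :
  1 <= Cmod t ->
  Re (phase s b w t) <=
    Cmod w * Cmod t + Cmod b / 4 * (Cmod t + 1 + 2 * PI) - Re (t ^ 2) / 2.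
Proof.
  intros Ht.
  assert (H0 : t <> 0%C) by (apply Cmod_gt_0; lra).
  assert (E : Re (phase s b w t) =
    Re (w * t) + Re (- (b / 4 * Clog_cont s t)) - Re (t ^ 2) / 2).
  { unfold phase, Re. simpl. field. }
  rewrite E.
  assert (H1 := Re_le_Cmod (w * t)). rewrite Cmod_mult in H1.
  assert (H2 := Re_le_Cmod (- (b / 4 * Clog_cont s t))%C).
  rewrite Cmod_opp, Cmod_mult in H2.
  assert (H4 : Cmod (b / 4) = Cmod b / 4).
  { rewrite Cmod_div by (intros K; injection K; lra).
    rewrite Cmod_R, Rabs_pos_eq by lra. reflexivity. }
  rewrite H4 in H2.
  assert (H3 := Clog_cont_bound s t H0).
  assert (/ Cmod t <= 1) by (rewrite <- Rinv_1; apply Rinv_le_contravar; lra).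
  assert (Cmod b / 4 * Cmod (Clog_cont s t)
          <= Cmod b / 4 * (Cmod t + 1 + 2 * PI)).
  { apply Rmult_le_compat_l; [generalize (Cmod_ge_0 b) |]; lra. }
  lra.
Qed.

Lemma phase_hol_derive (s : contour) (b w t : C) :
  cut_plane s t -> hol_derive (phase s b w) t (w - t - b / 4 / t)%C.
Proof.
  intros Ht. assert (Hn := cut_plane_neq_0 s t Ht).
  unfold phase.
  evar_last.
  - apply hol_derive_minus; [apply hol_derive_minus |].
    + apply hol_derive_linear.
    + apply (hol_derive_ext_loc (fun x => / 2 * (x * x))%C).
      { apply filter_forall. intros x. simpl. unfold Cdiv. ring. }
      apply hol_derive_mult; [apply hol_derive_const |].
      apply hol_derive_mult; apply hol_derive_id.
    + apply hol_derive_mult; [apply hol_derive_const |].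
      apply hol_derive_Clog_cont, Ht.
  - simpl. field. exact Hn.
Qed.

Definition gaussian_integrand (s : contour) (b w : C) (x : R) : C :=
  Cexp (phase s b w (gamma s x)).

Lemma gamma_affine (s : contour) (x : R) :
  gamma s x = (gamma s 0 + 1 * RtoC x)%C.
Proof. destruct s; apply C_eq; simpl; ring. Qed.

Lemma gamma_cut_plane (s : contour) (x : R) : cut_plane s (gamma s x).
Proof. destruct s; right; simpl; lra. Qed.

Lemma gamma_derive (s : contour) (x : R) : path_derive (gamma s) x (RtoC 1).
Proof.
  eapply is_derive_ext; [| apply (path_derive_affine (gamma s 0) 1 x)].
  intros t. symmetry. apply gamma_affine.
Qed.

Lemma Cmod_gamma_ge (s : contour) (x : R) : 1 <= Cmod (gamma s x).
Proof.
  eapply Rle_trans; [| apply Cmod_Im_le].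
  destruct s; simpl; [rewrite Rabs_R1 | rewrite Rabs_left by lra]; lra.
Qed.

Lemma Cmod_gamma_le (s : contour) (x : R) : Cmod (gamma s x) <= Rabs x + 1.
Proof.
  eapply Rle_trans; [apply Cmod_le_ReIm |].
  destruct s; simpl; [rewrite Rabs_R1 | rewrite (Rabs_left (-1)) by lra]; lra.
Qed.

Lemma gaussian_integrand_continuous (s : contour) (b w : C) (x : R) :
  Ccontinuous (gaussian_integrand s b w) x.
Proof.
  apply (path_derive_continuous _ x
    (Cexp (phase s b w (gamma s x)) *
     ((w - gamma s x - b / 4 / gamma s x) * 1))%C).
  apply (path_derive_comp Cexp (fun x => phase s b w (gamma s x)));
    [apply hol_derive_Cexp |].
  apply (path_derive_comp (phase s b w) (gamma s)); [| apply gamma_derive].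
  apply phase_hol_derive, gamma_cut_plane.
Qed.

Lemma U_integrand (s : contour) (a w : C) (x : R) :
  (Cexp (w * gamma s x - gamma s x ^ 2 / 2) * Cpower (gamma s x) (a - 1 / 2))%C
  = gaussian_integrand s (- (4 * (a - 1 / 2))) w x.
Proof.
  unfold gaussian_integrand, phase, Cpower.
  rewrite <- Cexp_plus, Clog_cont_gamma. f_equal. field.
Qed.

(** The decay of the Gaussian beats every exponential; the majorant comes from
    completing the square. *)
Lemma gaussian_integrand_dominated (s : contour) (b w : C) (N : R) :
  exists M, forall x,
    exp (N * Rabs x) * Cmod (gaussian_integrand s b w x) <= M * exp (- Rabs x).
Proof.
  set (A := N + Cmod w + Cmod b / 4).
  set (B := Cmod w + Cmod b / 4 * (2 + 2 * PI) + 1 / 2).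
  exists (exp (B + (A + 1) ^ 2 / 2)). intros x.
  unfold gaussian_integrand. rewrite Cmod_Cexp, <- !exp_plus.
  assert (H := Re_phase_le s b w _ (Cmod_gamma_ge s x)).
  assert (Hg := Cmod_gamma_le s x).
  assert (E : Re (gamma s x ^ 2) = Rabs x ^ 2 - 1).
  { rewrite pow2_abs. destruct s; simpl; ring. }
  rewrite E in H. set (y := Rabs x) in *.
  assert (Hw := Cmod_ge_0 w). assert (Hb := Cmod_ge_0 b).
  assert (K : N * y + Re (phase s b w (gamma s x))
              <= B + (A + 1) ^ 2 / 2 + - y).
  { assert (H1 : Cmod w * Cmod (gamma s x) <= Cmod w * (y + 1))
      by (apply Rmult_le_compat_l; lra).
    assert (H2 : Cmod b / 4 * (Cmod (gamma s x) + 1 + 2 * PI)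
                 <= Cmod b / 4 * (y + 1 + 1 + 2 * PI))
      by (apply Rmult_le_compat_l; lra).
    assert (H3 := pow2_ge_0 (y - (A + 1))).
    unfold A, B in *. nra. }
  destruct K as [K | K]; [apply Rlt_le, exp_increasing, K | rewrite K; lra].
Qed.

Lemma Rabs_le_exp (x : R) : Rabs x + 1 <= exp (Rabs x).
Proof.
  destruct (Req_dec (Rabs x) 0) as [E | E].
  - rewrite E, exp_0. lra.
  - generalize (exp_ineq1 _ E). lra.
Qed.

Lemma Cexp_increment_le (y : C) : Cmod (Cexp y - 1) <= Cmod y * exp (Cmod y).
Proof.
  replace (Cexp y - 1)%C with (Cexp (0 + y * RtoC 1) - Cexp (0 + y * RtoC 0))%C.
  2:{ replace (0 + y * RtoC 1)%C with y by ring.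
      replace (0 + y * RtoC 0)%C with (RtoC 0) by ring. now rewrite Cexp_0. }
  apply (path_mean_value (fun s => Cexp (0 + y * RtoC s))
                         (fun s => Cexp (0 + y * RtoC s) * y)%C).
  intros s Hs. split.
  - apply (path_derive_comp Cexp (fun s => (0 + y * RtoC s)%C));
      [apply hol_derive_Cexp | apply path_derive_affine].
  - rewrite Cmod_mult, Cmod_Cexp, Rmult_comm.
    apply Rmult_le_compat_l; [apply Cmod_ge_0 |].
    assert (K : Re (0 + y * RtoC s) <= Cmod y).
    { eapply Rle_trans; [apply Re_le_Cmod |]. rewrite Cplus_0_l, Cmod_mult, Cmod_R.
      rewrite Rabs_pos_eq by lra. generalize (Cmod_ge_0 y). nra. }
    destruct K as [K | K]; [apply Rlt_le, exp_increasing, K | rewrite K; lra].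
Qed.

Lemma Cexp_taylor_le (y : C) :
  Cmod (Cexp y - 1 - y) <= Cmod y ^ 2 * exp (Cmod y).
Proof.
  assert (Py := Cmod_ge_0 y).
  set (f := fun s : R => (Cexp (0 + y * RtoC s) + (0 + - y * RtoC s))%C).
  replace (Cexp y - 1 - y)%C with (f 1 - f 0)%C.
  2:{ unfold f. replace (0 + y * RtoC 1)%C with y by ring.
      replace (0 + y * RtoC 0)%C with (RtoC 0) by ring. rewrite Cexp_0. ring. }
  apply (path_mean_value f (fun s => Cexp (0 + y * RtoC s) * y + - y)%C).
  intros s Hs. split.
  - apply (is_derive_plus (V := C_R_NormedModule)).
    + apply (path_derive_comp Cexp (fun s => (0 + y * RtoC s)%C));
        [apply hol_derive_Cexp | apply path_derive_affine].
    + apply path_derive_affine.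
  - replace (Cexp (0 + y * RtoC s) * y + - y)%C
      with (y * (Cexp (y * RtoC s) - 1))%C by (rewrite Cplus_0_l; ring).
    rewrite Cmod_mult.
    replace (Cmod y ^ 2 * exp (Cmod y)) with (Cmod y * (Cmod y * exp (Cmod y))) by ring.
    apply Rmult_le_compat_l; [exact Py |].
    eapply Rle_trans; [apply Cexp_increment_le |].
    assert (K : Cmod (y * RtoC s) <= Cmod y).
    { rewrite Cmod_mult, Cmod_R, Rabs_pos_eq by lra. nra. }
    apply Rmult_le_compat; [apply Cmod_ge_0 | apply Rlt_le, exp_pos | exact K |].
    destruct K as [K | K]; [apply Rlt_le, exp_increasing, K | rewrite K; lra].
Qed.

Definition gaussian_integral (s : contour) (b w : C) : C :=
  RInt_gen (V := C_R_CompleteNormedModule) (gaussian_integrand s b w)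
    (Rbar_locally m_infty) (Rbar_locally p_infty).

Lemma gaussian_integral_correct (s : contour) (b w : C) :
  is_line_int (gaussian_integrand s b w) (gaussian_integral s b w).
Proof.
  apply (RInt_gen_correct (V := C_R_CompleteNormedModule)).
  destruct (gaussian_integrand_dominated s b w 0) as [M HM].
  apply (exp_dominated_line_int M).
  - apply gaussian_integrand_continuous.
  - intros x. generalize (HM x). rewrite Rmult_0_l, exp_0. lra.
Qed.

Lemma U_gaussian_integral (s : contour) (a w : C) :
  U s a w = (Cexp (- (w ^ 2 / 4)) * gaussian_integral s (- (4 * (a - 1 / 2))) w)%C.
Proof.
  unfold U, gaussian_integral. do 2 f_equal.
  apply functional_extensionality. intros x. apply U_integrand.
Qed.

Lemma gaussian_moment_continuous (s : contour) (b w : C) (x : R) :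
  Ccontinuous (fun x => (gamma s x * gaussian_integrand s b w x)%C) x.
Proof.
  apply continuous_Cmult.
  - apply (path_derive_continuous _ _ _ (gamma_derive s x)).
  - apply gaussian_integrand_continuous.
Qed.

Lemma gaussian_moment_exists (s : contour) (b w : C) :
  exists l, is_line_int (fun x => (gamma s x * gaussian_integrand s b w x)%C) l.
Proof.
  destruct (gaussian_integrand_dominated s b w 1) as [M HM].
  apply (exp_dominated_line_int M).
  - intros x. apply gaussian_moment_continuous.
  - intros x. rewrite Cmod_mult. eapply Rle_trans; [| apply HM].
    apply Rmult_le_compat_r; [apply Cmod_ge_0 |]. rewrite Rmult_1_l.
    generalize (Cmod_gamma_le s x) (Rabs_le_exp x). lra.
Qed.

(** The second order remainder of [exp (h * t)] leaves a factor [Cmod h ^ 2]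
    times a function that is integrable uniformly in [Cmod h <= 1]. *)
Lemma gaussian_integral_hol_derive (s : contour) (b z l : C) :
  is_line_int (fun x => (gamma s x * gaussian_integrand s b z x)%C) l ->
  hol_derive (gaussian_integral s b) z l.
Proof.
  intros Hl. apply hol_derive_eps. intros eps.
  (* The remainder costs three factors [exp (Rabs x)]: two for [Cmod t ^ 2] and
     one for [exp (Cmod (h * t))]. *)
  destruct (gaussian_integrand_dominated s b z 3) as [M HM].
  assert (HM0 : 0 <= M).
  { generalize (HM 0) (Cmod_ge_0 (gaussian_integrand s b z 0)).
    rewrite Rabs_R0, Rmult_0_r, Ropp_0, exp_0. lra. }
  set (M' := M * exp 1).
  assert (HM' : 0 <= M') by (apply Rmult_le_pos; [exact HM0 | apply Rlt_le, exp_pos]).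
  assert (Hd : 0 < Rmin 1 (eps / (2 * M' + 1))).
  { apply Rmin_pos; [lra |]. apply Rdiv_lt_0_compat; [apply cond_pos | lra]. }
  exists (mkposreal _ Hd). cbn [pos]. intros w Hw.
  set (h := (w - z)%C) in *.
  assert (Hh1 : Cmod h < 1) by (eapply Rlt_le_trans; [exact Hw | apply Rmin_l]).
  assert (Hh2 : Cmod h < eps / (2 * M' + 1))
    by (eapply Rlt_le_trans; [exact Hw | apply Rmin_r]).
  assert (Hh0 := Cmod_ge_0 h).
  apply Rle_trans with (2 * (Cmod h ^ 2 * M')).
  - apply (exp_dominated_line_int_le (Cmod h ^ 2 * M') (fun x =>
      (gaussian_integrand s b w x - gaussian_integrand s b z x
       - h * (gamma s x * gaussian_integrand s b z x))%C)).
    + intros x. unfold Cminus.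
      assert (H1 := gaussian_integrand_continuous s b w x).
      assert (H2 := gaussian_integrand_continuous s b z x).
      assert (H3 := gaussian_moment_continuous s b z x).
      apply continuous_Cplus; [apply continuous_Cplus; [exact H1 |] |];
      apply continuous_Copp; [exact H2 |].
      apply continuous_Cmult; [apply continuous_const | exact H3].
    + intros x. set (t := gamma s x).
      replace (gaussian_integrand s b w x - gaussian_integrand s b z x
               - h * (t * gaussian_integrand s b z x))%C
        with (gaussian_integrand s b z x * (Cexp (h * t) - 1 - h * t))%C.
      2:{ unfold gaussian_integrand. fold t.
          replace (phase s b w t) with (phase s b z t + h * t)%C
            by (unfold phase, h; ring).
          rewrite Cexp_plus. ring. }
      rewrite Cmod_mult.
      assert (Ht : Cmod t <= Rabs x + 1) by apply Cmod_gamma_le.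
      assert (Ht0 := Cmod_ge_0 t).
      assert (He := Rabs_le_exp x).
      assert (T : Cmod (Cexp (h * t) - 1 - h * t)
                  <= Cmod h ^ 2 * (exp 1 * exp (3 * Rabs x))).
      { eapply Rle_trans; [apply Cexp_taylor_le |].
        rewrite Cmod_mult, Rpow_mult_distr, Rmult_assoc.
        apply Rmult_le_compat_l; [apply pow2_ge_0 |].
        apply Rle_trans with (exp (Rabs x) ^ 2 * exp (Rabs x + 1)).
        - apply Rmult_le_compat; [apply pow2_ge_0 | apply Rlt_le, exp_pos | |].
          + apply pow_incr. lra.
          + assert (K : Cmod h * Cmod t <= Rabs x + 1) by nra.
            destruct K as [K | K]; [apply Rlt_le, exp_increasing, K | rewrite K; lra].
        - right. replace (exp (Rabs x) ^ 2) with (exp (Rabs x) * exp (Rabs x)) by ring.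
          rewrite <- !exp_plus. f_equal. ring. }
      eapply Rle_trans; [apply Rmult_le_compat_l; [apply Cmod_ge_0 | exact T] |].
      unfold M'.
      replace (Cmod (gaussian_integrand s b z x) *
               (Cmod h ^ 2 * (exp 1 * exp (3 * Rabs x))))
        with (Cmod h ^ 2 * exp 1 *
              (exp (3 * Rabs x) * Cmod (gaussian_integrand s b z x))) by ring.
      replace (Cmod h ^ 2 * (M * exp 1) * exp (- Rabs x))
        with (Cmod h ^ 2 * exp 1 * (M * exp (- Rabs x))) by ring.
      apply Rmult_le_compat_l; [| apply HM].
      apply Rmult_le_pos; [apply pow2_ge_0 | apply Rlt_le, exp_pos].
    + rewrite (Cmult_comm l).
      apply (is_RInt_gen_minus (V := C_R_NormedModule)).
      * apply (is_RInt_gen_minus (V := C_R_NormedModule));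
          apply gaussian_integral_correct.
      * apply is_line_int_Cmult, Hl.
  - apply Rle_trans with ((2 * M' + 1) * Cmod h * Cmod h).
    + simpl. nra.
    + apply Rmult_le_compat_r; [exact Hh0 |].
      apply Rlt_le in Hh2. apply Rle_div_r in Hh2; [lra | lra].
Qed.

(** * The line through the saddle point *)

Lemma exp_le (x y : R) : x <= y -> exp x <= exp y.
Proof.
  intros [H | H]; [apply Rlt_le, exp_increasing, H | rewrite H; lra].
Qed.

Lemma gaussian_le_exp (A B D y : R) :
  0 < D ->
  exp (A * y + B - D * y ^ 2) <= exp (B + (A + 1) ^ 2 / (4 * D)) * exp (- y).
Proof.
  intros HD. rewrite <- exp_plus. apply exp_le.
  assert (E : B + (A + 1) ^ 2 / (4 * D) + - y - (A * y + B - D * y ^ 2)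
              = D * (y - (A + 1) / (2 * D)) ^ 2) by (field; lra).
  assert (H := Rmult_le_pos _ _ (Rlt_le _ _ HD) (pow2_ge_0 (y - (A + 1) / (2 * D)))).
  lra.
Qed.

Definition decays (h : R -> C) : Prop :=
  exists M u0, 0 <= M /\
    forall u, u0 <= Rabs u -> Cmod (h u) <= M * exp (- Rabs u).

Lemma filterlim_C_plus {T : Type} (F : (T -> Prop) -> Prop) (f g : T -> C) (l m : C) :
  Filter F ->
  filterlim f F (locally (T := C_UniformSpace) l) ->
  filterlim g F (locally (T := C_UniformSpace) m) ->
  filterlim (fun x => (f x + g x)%C) F (locally (T := C_UniformSpace) (l + m)%C).
Proof.
  intros FF Hf Hg. eapply filterlim_comp_2; [exact Hf | exact Hg |].
  exact (filterlim_plus (V := C_R_NormedModule) l m).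
Qed.

Lemma decays_boundary (h : R -> C) :
  decays h ->
  filterlim (fun X => (h X - h (- X)%R)%C) (Rbar_locally p_infty)
    (locally (T := C_UniformSpace) (RtoC 0)).
Proof.
  intros [M [u0 [HM H]]] P HP. apply locally_C_Cmod in HP.
  destruct HP as [eps HP].
  destruct (exp_small (2 * M) eps ltac:(lra) (cond_pos eps)) as [A [HA HAe]].
  exists (Rmax A (Rabs u0)). intros X HX. apply HP.
  assert (H1 : A < X) by (eapply Rle_lt_trans; [apply Rmax_l | exact HX]).
  assert (H2 : u0 <= X).
  { apply Rlt_le. eapply Rle_lt_trans; [| exact HX].
    eapply Rle_trans; [apply Rle_abs | apply Rmax_r]. }
  assert (K1 := H X). assert (K2 := H (- X)).
  rewrite Rabs_Ropp in K2. rewrite Rabs_pos_eq in K1, K2 by lra.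
  replace (h X - h (- X)%R - 0)%C with (h X + - h (- X)%R)%C by ring.
  eapply Rle_lt_trans; [apply Cmod_triangle |]. rewrite Cmod_opp.
  assert (K3 := exp_le (- X) (- A) ltac:(lra)).
  specialize (K1 H2). specialize (K2 H2). nra.
Qed.

Lemma Cexp_Ci (alpha : R) : Cexp (Ci * alpha) = (cos alpha, sin alpha).
Proof.
  unfold Cexp. simpl. unfold Re, Im; simpl.
  replace (0 * alpha - 1 * 0) with 0 by ring.
  replace (0 * 0 + 1 * alpha) with alpha by ring. rewrite exp_0.
  f_equal; ring.
Qed.

Lemma Cmod_Cexp_Ci (alpha : R) : Cmod (Cexp (Ci * alpha)) = 1.
Proof.
  rewrite Cmod_Cexp. simpl. unfold Re; simpl.
  replace (0 * alpha - 1 * 0) with 0 by ring. apply exp_0.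
Qed.

Lemma Cmod_one_plus_ray_ge (alpha u : R) :
  1 / 2 <= sin alpha -> 1 / 2 <= Cmod (1 + Cexp (Ci * alpha) * u).
Proof.
  intros H. set (x := (1 + Cexp (Ci * alpha) * u)%C).
  assert (E : Cmod x ^ 2 = (u + cos alpha) ^ 2 + sin alpha ^ 2).
  { rewrite Cmod2_alt. unfold x. rewrite Cexp_Ci. simpl. unfold Re, Im; simpl.
    generalize (sin2_cos2 alpha). unfold Rsqr. intros K.
    replace (sin alpha * (sin alpha * 1)) with (1 - cos alpha * cos alpha) by lra.
    transitivity (1 + 2 * cos alpha * u
      + (sin alpha * sin alpha + cos alpha * cos alpha) * (u * u)); [ring |].
    rewrite K. ring. }
  generalize (Cmod_ge_0 x) (pow2_ge_0 (u + cos alpha)). nra.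
Qed.

Section SaddleLine.

Variables (s : contour) (b z t0 : C) (alpha D : R).
Let W : C := (t0 * Cexp (Ci * alpha))%C.
Let X := Re W.
Let Y := Im W.

Let p0 : C := (gamma s 0 + Re t0)%C.
Let zeta := segment p0 (RtoC X) t0 W.

Lemma Re_zeta (u v : R) : Re (zeta u v) = Re t0 + X * u.
Proof.
  unfold zeta, segment, p0. change X with (Re W). unfold Re.
  destruct s; simpl; ring.
Qed.

Lemma Im_zeta (u v : R) :
  Im (zeta u v) = (1 - v) * Im (gamma s 0) + v * (Im t0 + Y * u).
Proof.
  unfold zeta, segment, p0. change Y with (Im W). unfold Im.
  destruct s; simpl; ring.
Qed.

Lemma Cmod_zeta_le (u v : R) : 0 <= v <= 1 ->
  Cmod (zeta u v) <=
    (Rabs (Re t0) + 1 + Rabs (Im t0)) + (Rabs X + Rabs Y) * Rabs u.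
Proof.
  intros Hv. eapply Rle_trans; [apply Cmod_le_ReIm |].
  rewrite Re_zeta, Im_zeta.
  assert (H1 := Rabs_triang (Re t0) (X * u)). rewrite Rabs_mult in H1.
  assert (H2 := Rabs_triang (Im t0) (Y * u)). rewrite Rabs_mult in H2.
  assert (H3 := Rabs_triang ((1 - v) * Im (gamma s 0)) (v * (Im t0 + Y * u))).
  rewrite !Rabs_mult, (Rabs_pos_eq (1 - v)), (Rabs_pos_eq v) in H3 by lra.
  assert (Hg : Rabs (Im (gamma s 0)) = 1).
  { destruct s; simpl; [apply Rabs_R1 | rewrite Rabs_left; lra]. }
  rewrite Hg in H3. generalize (Rabs_pos (Im t0 + Y * u)). nra.
Qed.

Lemma Cmod_joining_le (u : R) :
  Cmod (t0 + W * u - (p0 + RtoC X * u)) <=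
    (Rabs (Re t0) + 1 + Rabs (Im t0)) + (Rabs X + Rabs Y) * Rabs u.
Proof.
  eapply Rle_trans; [apply Cmod_le_ReIm |].
  replace (Re (t0 + W * u - (p0 + RtoC X * u))%C) with 0.
  2:{ unfold p0. change X with (Re W). unfold Re. destruct s; simpl; ring. }
  replace (Im (t0 + W * u - (p0 + RtoC X * u))%C)
    with (Im t0 + Y * u + - Im (gamma s 0)).
  2:{ unfold p0. change Y with (Im W). unfold Im. destruct s; simpl; ring. }
  assert (Hg : Rabs (Im (gamma s 0)) = 1).
  { destruct s; simpl; [apply Rabs_R1 | rewrite Rabs_left; lra]. }
  assert (H2 := Rabs_triang (Im t0) (Y * u)). rewrite Rabs_mult in H2.
  assert (H3 := Rabs_triang (Im t0 + Y * u) (- Im (gamma s 0))).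
  rewrite Rabs_Ropp, Hg in H3. rewrite Rabs_R0.
  generalize (Rabs_pos (Re t0)) (Rmult_le_pos _ _ (Rabs_pos X) (Rabs_pos u)). lra.
Qed.

Lemma saddle_line_factor (u : R) :
  (t0 + W * u = t0 * (1 + Cexp (Ci * alpha) * u))%C.
Proof. unfold W. ring. Qed.

(** The origin lies on a definite side of the line: where the line meets the
    imaginary axis, [Re t0 = - X * u] and the identity gives the sign of
    its height there times [X]. With the choice of contour, this point is not on
    the cut. *)
Lemma saddle_line_cross : Re t0 * Y - Im t0 * X = Cmod t0 ^ 2 * sin alpha.
Proof.
  unfold X, Y, W. rewrite Cexp_Ci, Cmod2_alt. unfold Re, Im; simpl. ring.
Qed.

Hypothesis t0_neq_0 : t0 <> 0%C.
Hypothesis sin_alpha : 1 / 2 <= sin alpha.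
Hypothesis D_pos : 0 < D.
Hypothesis descent : forall u : R,
  Re (phase s b z (t0 + W * u)) - Re (phase s b z t0) <= - D * u ^ 2.

Lemma Cmod_saddle_line_ge (u : R) : Cmod t0 / 2 <= Cmod (t0 + W * u).
Proof.
  rewrite saddle_line_factor, Cmod_mult.
  generalize (Cmod_one_plus_ray_ge alpha u sin_alpha) (Cmod_ge_0 t0). nra.
Qed.

Lemma saddle_line_neq_0 (u : R) : (t0 + W * u)%C <> 0%C.
Proof.
  apply Cmod_gt_0. generalize (Cmod_saddle_line_ge u) (proj1 (Cmod_gt_0 t0) t0_neq_0).
  lra.
Qed.

(** Along the line the exponent is quadratic up to terms of linear growth, so
    its decay controls the leading coefficient: the line is flatter than the
    diagonals, as is needed to rotate the contour onto it. *)
Lemma saddle_line_slope : 2 * D <= X ^ 2 - Y ^ 2.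
Proof.
  assert (Ht := proj1 (Cmod_gt_0 t0) t0_neq_0).
  set (c := (z * W - t0 * W)%C).
  set (L0 := Cmod (Clog_cont s t0)).
  set (L := Cmod t0 + / (Cmod t0 / 2) + 2 * PI).
  set (c1 := Cmod c + Cmod b / 4 * Cmod W).
  set (c2 := Cmod b / 4 * (L + L0)).
  assert (P := PI_RGT_0). assert (Pb := Cmod_ge_0 b). assert (PW := Cmod_ge_0 W).
  assert (Pc := Cmod_ge_0 c).
  assert (PL0 : 0 <= L0) by apply Cmod_ge_0.
  assert (PL : 0 <= L).
  { unfold L. assert (0 < / (Cmod t0 / 2)) by (apply Rinv_0_lt_compat; lra). lra. }
  assert (H : forall u, 0 <= u ->
             (D - (X ^ 2 - Y ^ 2) / 2) * u ^ 2 <= c1 * u + c2).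
  { intros u Hu. assert (Hd := descent u).
    assert (E : Re (phase s b z (t0 + W * u)) - Re (phase s b z t0)
      = - ((X ^ 2 - Y ^ 2) / 2) * u ^ 2 + Re (c * u)
        + Re (- (b / 4) * (Clog_cont s (t0 + W * u) - Clog_cont s t0))).
    { unfold phase, c, X, Y, Re, Im. simpl. field. }
    rewrite E in Hd.
    assert (H1 : - (Cmod c * u) <= Re (c * u)).
    { generalize (re_le_Cmod (c * u)). rewrite Cmod_mult, Cmod_R, (Rabs_pos_eq u) by lra.
      intros K. apply Rabs_le_between in K. lra. }
    assert (H2 : - (Cmod b / 4 * (L + Cmod W * u + L0)) <=
       Re (- (b / 4) * (Clog_cont s (t0 + W * u) - Clog_cont s t0))).
    { generalize (re_le_Cmod (- (b / 4) * (Clog_cont s (t0 + W * u) - Clog_cont s t0))).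
      rewrite Cmod_mult, Cmod_opp, Cmod_div, Cmod_R, (Rabs_pos_eq 4) by
        (lra || (intros K; injection K; lra)).
      assert (K : Cmod (Clog_cont s (t0 + W * u) - Clog_cont s t0)
                  <= L + Cmod W * u + L0).
      { unfold Cminus. eapply Rle_trans; [apply Cmod_triangle |].
        rewrite Cmod_opp. fold L0. apply Rplus_le_compat_r.
        eapply Rle_trans; [apply Clog_cont_bound, saddle_line_neq_0 |].
        assert (K1 : Cmod (t0 + W * u) <= Cmod t0 + Cmod W * u).
        { eapply Rle_trans; [apply Cmod_triangle |].
          rewrite Cmod_mult, Cmod_R, Rabs_pos_eq by lra. lra. }
        assert (K2 : / Cmod (t0 + W * u) <= / (Cmod t0 / 2)).
        { apply Rinv_le_contravar; [lra | apply Cmod_saddle_line_ge]. }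
        unfold L. lra. }
      intros K1. apply Rabs_le_between in K1.
      assert (Cmod b / 4 * Cmod (Clog_cont s (t0 + W * u) - Clog_cont s t0)
              <= Cmod b / 4 * (L + Cmod W * u + L0))
        by (apply Rmult_le_compat_l; lra).
      lra. }
    unfold c1, c2. lra. }
  destruct (Rle_lt_dec (2 * D) (X ^ 2 - Y ^ 2)) as [| Hlt]; [assumption | exfalso].
  set (e := D - (X ^ 2 - Y ^ 2) / 2) in *.
  assert (He : 0 < e) by (unfold e; lra).
  assert (P1 : 0 <= c1) by (unfold c1; apply Rplus_le_le_0_compat; [lra |];
                            apply Rmult_le_pos; lra).
  assert (P2 : 0 <= c2) by (unfold c2; apply Rmult_le_pos; lra).
  set (u := 1 + (c1 + c2) / e).
  assert (Hu : 1 <= u).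
  { unfold u. assert (0 <= (c1 + c2) / e) by (apply Rdiv_le_0_compat; lra). lra. }
  assert (Eu : e * u = e + c1 + c2) by (unfold u; field; lra).
  specialize (H u ltac:(lra)). nra.
Qed.

Lemma X_neq_0 : X <> 0.
Proof. generalize saddle_line_slope. intros H E. rewrite E in H. nra. Qed.

Hypothesis contour_side : s = if Rlt_dec X 0 then Gamma_plus else Gamma_minus.

Lemma contour_orientation :
  (s = Gamma_plus /\ X < 0) \/ (s = Gamma_minus /\ 0 < X).
Proof.
  assert (H := X_neq_0). revert contour_side. destruct Rlt_dec; intros Es; [left | right];
  (split; [exact Es | lra]).
Qed.

(** A point of a joining segment on the imaginary axis lies between a point of the contour and a
    point of the slanted line, both on the side opposite to the cut. *)
Lemma zeta_cut_plane (u v : R) : 0 <= v <= 1 -> cut_plane s (zeta u v).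
Proof.
  intros Hv. assert (Hx := X_neq_0).
  destruct (Req_dec (Re t0 + X * u) 0) as [E | E].
  - assert (K : X * (Im t0 + Y * u) < 0).
    { assert (K := saddle_line_cross).
      assert (0 < Cmod t0 ^ 2) by (apply pow_lt, Cmod_gt_0, t0_neq_0).
      assert (0 < Cmod t0 ^ 2 * sin alpha) by (apply Rmult_lt_0_compat; lra).
      replace (X * (Im t0 + Y * u))
        with (Y * (Re t0 + X * u) - (Re t0 * Y - Im t0 * X)) by ring.
      rewrite E, K. lra. }
    assert (HI := Im_zeta u v).
    destruct contour_orientation as [[Es HX] | [Es HX]].
    + assert (Hc : forall t, 0 < Im t -> cut_plane s t)
        by (rewrite Es; intros t Ht; right; exact Ht).
      apply Hc. rewrite HI.
      replace (Im (gamma s 0)) with 1 by (rewrite Es; reflexivity).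
      assert (0 < Im t0 + Y * u) by nra.
      assert (0 <= v * (Im t0 + Y * u)) by (apply Rmult_le_pos; lra).
      destruct (Req_dec v 1); [subst v |]; lra.
    + assert (Hc : forall t, Im t < 0 -> cut_plane s t)
        by (rewrite Es; intros t Ht; right; exact Ht).
      apply Hc. rewrite HI.
      replace (Im (gamma s 0)) with (-1) by (rewrite Es; reflexivity).
      assert (Im t0 + Y * u < 0) by nra.
      assert (v * (Im t0 + Y * u) <= 0) by nra.
      destruct (Req_dec v 1); [subst v |]; lra.
  - assert (HR := Re_zeta u v).
    destruct s; left; rewrite HR; exact E.
Qed.

Lemma saddle_line_cut_plane (u : R) : cut_plane s (t0 + W * u)%C.
Proof.
  replace (t0 + W * u)%C with (zeta u 1) by (unfold zeta, segment; ring).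
  apply zeta_cut_plane; lra.
Qed.

Lemma Re_zeta_sqr_ge (u v : R) : 0 <= v <= 1 ->
  2 * D * Rabs u ^ 2
  - 2 * (Rabs (Re t0 * X) + Rabs (Im t0 * Y)) * Rabs u - (1 + Im t0 ^ 2)
  <= Re (zeta u v ^ 2).
Proof.
  intros Hv.
  assert (E : Re (zeta u v ^ 2) = Re (zeta u v) ^ 2 - Im (zeta u v) ^ 2).
  { unfold Re, Im; simpl; ring. }
  rewrite E, Re_zeta, Im_zeta.
  set (g := Im (gamma s 0)).
  assert (Hg : g ^ 2 = 1) by (unfold g; destruct s; simpl; ring).
  set (m := Im t0 + Y * u).
  assert (Hc : ((1 - v) * g + v * m) ^ 2 <= 1 + m ^ 2).
  { assert (H : ((1 - v) * g + v * m) ^ 2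
       = (1 - v) * g ^ 2 + v * m ^ 2 - v * (1 - v) * (g - m) ^ 2) by ring.
    assert (0 <= v * (1 - v) * (g - m) ^ 2).
    { apply Rmult_le_pos; [nra | apply pow2_ge_0]. }
    rewrite H, Hg. generalize (pow2_ge_0 m). nra. }
  assert (H1 : - (Rabs (Re t0 * X) * Rabs u) <= Re t0 * X * u).
  { rewrite <- Rabs_mult. generalize (Rle_abs (- (Re t0 * X * u))).
    rewrite Rabs_Ropp. lra. }
  assert (H2 : Im t0 * Y * u <= Rabs (Im t0 * Y) * Rabs u).
  { rewrite <- Rabs_mult. apply Rle_abs. }
  assert (H3 : 2 * D * u ^ 2 <= (X ^ 2 - Y ^ 2) * u ^ 2).
  { apply Rmult_le_compat_r; [apply pow2_ge_0 | apply saddle_line_slope]. }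
  rewrite pow2_abs. unfold m in *. nra.
Qed.

Variables c0 c1 : C.

Let G (t : C) : C := ((c0 + c1 * t) * Cexp (phase s b z t))%C.
Let G' (t : C) : C :=
  (c1 * Cexp (phase s b z t)
   + (c0 + c1 * t) * ((z - t - b / 4 * / t) * Cexp (phase s b z t)))%C.

Lemma integrand_derive (t : C) : cut_plane s t -> hol_derive G t (G' t).
Proof.
  intros Ht. evar_last.
  - apply hol_derive_mult.
    + apply hol_derive_plus; [apply hol_derive_const | apply hol_derive_linear].
    + apply (hol_derive_comp Cexp (phase s b z));
        [apply hol_derive_Cexp | apply phase_hol_derive, Ht].
  - unfold G', Cdiv. apply (@eq_sym C). ring.
Qed.

Lemma integrand_derive_continuous (t : C) : cut_plane s t -> CCcontinuous G' t.
Proof.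
  intros Ht. assert (Hn := cut_plane_neq_0 s t Ht).
  assert (HE : CCcontinuous (fun t => Cexp (phase s b z t)) t).
  { apply (hol_derive_continuous _ t
      ((z - t - b / 4 / t) * Cexp (phase s b z t))%C).
    apply (hol_derive_comp Cexp (phase s b z));
      [apply hol_derive_Cexp | apply phase_hol_derive, Ht]. }
  assert (HI := continuous_Cinv t Hn).
  assert (Hid : CCcontinuous (fun t => t) t) by apply continuous_id.
  unfold G', Cminus. solve_continuous_C.
Qed.

(** At the point [x + i * y] of a joining segment, [y ^ 2] is at most the larger
    of its values at the end points, so the real part of the square still grows
    like [2 * D * u ^ 2]. *)
Lemma integrand_on_segments_decays :
  exists (M u0 : R) (B : R -> R), 0 <= M /\ forall u, u0 <= Rabs u ->
    (forall v, 0 <= v <= 1 -> Cmod (G (zeta u v)) <= B u) /\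
    B u * Cmod (t0 + W * u - (p0 + RtoC X * u)) <= M * exp (- Rabs u).
Proof.
  set (C3 := Rabs (Re t0) + 1 + Rabs (Im t0)).
  set (C4 := Rabs X + Rabs Y).
  set (K := Cmod c0 + Cmod c1).
  set (A1 := C4 * (1 + Cmod z + Cmod b / 4) + (Rabs (Re t0 * X) + Rabs (Im t0 * Y))).
  set (B1 := C3 * (1 + Cmod z + Cmod b / 4) + Cmod b / 4 * (1 + 2 * PI)
             + (1 + Im t0 ^ 2) / 2).
  assert (PK : 0 <= K) by (unfold K; generalize (Cmod_ge_0 c0) (Cmod_ge_0 c1); lra).
  exists (K * exp (C3 + B1 + (C4 + A1 + 1) ^ 2 / (4 * D))),
         ((1 + Rabs (Re t0)) / Rabs X),
         (fun u => K * exp (A1 * Rabs u + B1 - D * Rabs u ^ 2)).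
  split; [apply Rmult_le_pos; [exact PK | apply Rlt_le, exp_pos] |].
  intros u Hu. set (y := Rabs u) in *.
  assert (Py : 0 <= y) by apply Rabs_pos.
  assert (PX : 0 < Rabs X) by (apply Rabs_pos_lt, X_neq_0).
  split.
  - intros v Hv. unfold G. rewrite Cmod_mult, Cmod_Cexp.
    set (t := zeta u v).
    assert (Ht : Cmod t <= C3 + C4 * y) by (apply Cmod_zeta_le; exact Hv).
    assert (H1 : 1 <= Cmod t).
    { eapply Rle_trans; [| apply re_le_Cmod]. unfold t. rewrite Re_zeta.
      apply Rle_div_l in Hu; [| exact PX].
      assert (K1 := Rabs_triang (Re t0 + X * u) (- Re t0)).
      replace (Re t0 + X * u + - Re t0) with (X * u) in K1 by ring.
      rewrite Rabs_Ropp, Rabs_mult in K1. fold y in K1. lra. }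
    assert (HR := Re_phase_le s b z t H1).
    assert (HS : 2 * D * y ^ 2
      - 2 * (Rabs (Re t0 * X) + Rabs (Im t0 * Y)) * y - (1 + Im t0 ^ 2)
      <= Re (t ^ 2)) by (apply Re_zeta_sqr_ge; exact Hv).
    assert (HP : Cmod (c0 + c1 * t) <= K * exp (Cmod t)).
    { eapply Rle_trans; [apply Cmod_triangle |]. rewrite Cmod_mult.
      assert (HE := Rabs_le_exp (Cmod t)).
      rewrite Rabs_pos_eq in HE by apply Cmod_ge_0.
      unfold K. generalize (Cmod_ge_0 c0) (Cmod_ge_0 c1) (Cmod_ge_0 t). nra. }
    apply Rle_trans with (K * exp (Cmod t) * exp (Re (phase s b z t))).
    { apply Rmult_le_compat_r; [apply Rlt_le, exp_pos | exact HP]. }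
    rewrite Rmult_assoc, <- exp_plus. apply Rmult_le_compat_l; [exact PK |].
    apply exp_le.
    assert (Pz := Cmod_ge_0 z). assert (Pb := Cmod_ge_0 b).
    assert (Q1 : Cmod z * Cmod t <= Cmod z * (C3 + C4 * y))
      by (apply Rmult_le_compat_l; assumption).
    assert (Q2 : Cmod b / 4 * (Cmod t + 1 + 2 * PI)
                 <= Cmod b / 4 * (C3 + C4 * y + 1 + 2 * PI))
      by (apply Rmult_le_compat_l; lra).
    unfold A1, B1. nra.
  - assert (HJ : Cmod (t0 + W * u - (p0 + RtoC X * u)) <= exp (C3 + C4 * y)).
    { assert (HJ : Cmod (t0 + W * u - (p0 + RtoC X * u)) <= C3 + C4 * y)
        by apply Cmod_joining_le.
      assert (HE := Rabs_le_exp (C3 + C4 * y)).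
      assert (P : 0 <= C3 + C4 * y) by (eapply Rle_trans; [apply Cmod_ge_0 | exact HJ]).
      rewrite Rabs_pos_eq in HE by exact P. lra. }
    apply Rle_trans with (K * exp (A1 * y + B1 - D * y ^ 2) * exp (C3 + C4 * y)).
    { apply Rmult_le_compat_l; [| exact HJ].
      apply Rmult_le_pos; [exact PK | apply Rlt_le, exp_pos]. }
    rewrite !Rmult_assoc, <- exp_plus. apply Rmult_le_compat_l; [exact PK |].
    eapply Rle_trans; [| apply (gaussian_le_exp (C4 + A1) (C3 + B1) D y D_pos)].
    right. f_equal. ring.
Qed.

(** The integrals over the joining segments are the boundary terms of Cauchy's
    theorem, and they tend to zero. The sign accounts for the direction in which
    the line is run through. *)
Lemma deformation (N : C) :
  is_line_int (fun x => G (gamma s x)) N ->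
  filterlim (fun T => path_int (fun u => (G (t0 + W * RtoC u) * W)%C) (- T) T)
    (Rbar_locally p_infty)
    (locally (T := C_UniformSpace) (if Rlt_dec X 0 then (- N)%C else N)).
Proof.
  intros HN.
  destruct (joining_segment_primitive (cut_plane s) G G' p0 (RtoC X) t0 W
    (cut_plane_open s) integrand_derive integrand_derive_continuous zeta_cut_plane)
    as [h [Hh Hb]].
  assert (Hdec : decays h).
  { destruct integrand_on_segments_decays as [M [u0 [B [HM HB]]]].
    exists M, u0. split; [exact HM |]. intros u Hu.
    destruct (HB u Hu) as [H1 H2].
    eapply Rle_trans; [apply (Hb u (B u) H1) | exact H2]. }
  assert (Hg : forall x, Ccontinuous (fun x => G (gamma s x)) x).
  { intros x.
    apply (path_derive_continuous _ x (G' (gamma s x) * 1)%C).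
    apply (path_derive_comp G (gamma s)); [| apply gamma_derive].
    apply integrand_derive, gamma_cut_plane. }
  assert (Hline : forall p q u, cut_plane s (p + q * RtoC u)%C ->
            Ccontinuous (fun x => (G (p + q * RtoC x) * q)%C) u).
  { intros p q u Hc. apply continuous_Cmult; [| apply continuous_const].
    apply (path_derive_continuous _ u (G' (p + q * RtoC u) * q)%C).
    apply (path_derive_comp G (fun x => (p + q * RtoC x)%C));
      [apply integrand_derive, Hc | apply path_derive_affine]. }
  assert (Cp : forall u, cut_plane s (p0 + RtoC X * RtoC u)%C).
  { intros u. replace (p0 + RtoC X * RtoC u)%C with (zeta u 0)
      by (unfold zeta, segment; ring).
    apply zeta_cut_plane; lra. }
  assert (Cq : forall u, cut_plane s (t0 + W * RtoC u)%C).
  { exact saddle_line_cut_plane. }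
  assert (Hp0 : forall u, (p0 + RtoC X * RtoC u)%C = gamma s (X * u + Re t0)).
  { intros u. unfold p0. destruct s; apply C_eq; simpl; ring. }
  assert (Hhor : forall T, is_path_int
            (fun u => (G (p0 + RtoC X * RtoC u) * RtoC X)%C) (- T) T
            (path_int (fun x => G (gamma s x)) (X * - T + Re t0) (X * T + Re t0))).
  { intros T.
    apply (is_RInt_ext (V := C_R_NormedModule)
      (fun y => scal X (G (gamma s (X * y + Re t0))))).
    - intros u _. rewrite Hp0. apply C_eq; unfold scal; simpl; unfold scal; simpl;
      unfold mult; simpl; unfold Re, Im; ring.
    - apply (is_RInt_comp_lin (V := C_R_NormedModule)
        (fun x => G (gamma s x)) X (Re t0) (- T) T).
      apply is_path_int_continuous, Hg. }
  assert (Hdiff : forall T,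
    (path_int (fun u => (G (t0 + W * RtoC u) * W)%C) (- T) T)
    = ((h T - h (- T)%R) +
       path_int (fun x => G (gamma s x)) (X * - T + Re t0) (X * T + Re t0))%C).
  { intros T. apply (is_RInt_unique (V := C_R_CompleteNormedModule)).
    assert (HI : is_path_int (fun u => (G (t0 + W * RtoC u) * W
                     - G (p0 + RtoC X * RtoC u) * RtoC X)%C) (- T) T (h T - h (- T)%R)%C).
    { apply (is_RInt_derive (V := C_R_CompleteNormedModule)).
      - intros u _. apply Hh.
      - intros u _. unfold Cminus. apply continuous_Cplus; [apply Hline, Cq |].
        apply continuous_Copp, Hline, Cp. }
    eapply is_RInt_ext; [| apply (is_RInt_plus (V := C_R_NormedModule) _ _ _ _ _ _ HI (Hhor T))].
    intros u _. apply (@eq_trans C) with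
      ((G (t0 + W * RtoC u) * W - G (p0 + RtoC X * RtoC u) * RtoC X)
        + G (p0 + RtoC X * RtoC u) * RtoC X)%C; [reflexivity | ring]. }
  apply (filterlim_ext (fun T => ((h T - h (- T)%R) +
       path_int (fun x => G (gamma s x)) (X * - T + Re t0) (X * T + Re t0))%C)).
  { intros T. symmetry. apply Hdiff. }
  assert (Hup : forall k c, 0 < k ->
    filterlim (fun T => k * T + c) (Rbar_locally p_infty) (Rbar_locally p_infty)).
  { intros k c Hk P [A HA]. exists ((A - c) / k). intros x Hx. apply HA.
    apply Rlt_div_l in Hx; lra. }
  assert (Hdown : forall k c, k < 0 ->
    filterlim (fun T => k * T + c) (Rbar_locally p_infty) (Rbar_locally m_infty)).
  { intros k c Hk P [A HA]. exists ((c - A) / - k). intros x Hx. apply HA.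
    apply Rlt_div_l in Hx; lra. }
  assert (Eop : forall T, X * - T + Re t0 = - X * T + Re t0) by (intros; ring).
  destruct (Rlt_dec X 0) as [HX | HX].
  - replace (- N)%C with (0 + - N)%C by ring.
    apply filterlim_C_plus; [apply Rbar_locally_filter | apply decays_boundary, Hdec |].
    apply (filterlim_ext (fun T => (- path_int (fun x => G (gamma s x))
                                      (X * T + Re t0) (- X * T + Re t0))%C)).
    { intros T. rewrite Eop.
      apply (opp_RInt_swap (V := C_R_CompleteNormedModule)).
      eexists. apply is_path_int_continuous, Hg. }
    eapply filterlim_comp; [| exact (filterlim_opp (V := C_R_NormedModule) N)].
    apply line_int_truncation; [exact HN | |].
    + apply Hdown, HX.
    + apply Hup. lra.
  - replace N with (0 + N)%C by ring.
    apply filterlim_C_plus; [apply Rbar_locally_filter | apply decays_boundary, Hdec |].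
    assert (HX' := X_neq_0).
    apply (filterlim_ext (fun T => path_int (fun x => G (gamma s x))
                                      (- X * T + Re t0) (X * T + Re t0))).
    { intros T. rewrite Eop. reflexivity. }
    apply line_int_truncation; [exact HN | |].
    + apply Hdown. lra.
    + apply Hup. lra.
Qed.

End SaddleLine.

(** * The estimate on the line *)

Section SaddleEstimate.

Variables (s : contour) (b z t0 sq : C) (alpha D : R).
Let omega : C := Cexp (Ci * alpha).
Let W : C := (t0 * omega)%C.

Hypothesis t0_neq_0 : t0 <> 0%C.
Hypothesis sin_alpha : 1 / 2 <= sin alpha.
Hypothesis D_pos : 0 < D.
Hypothesis descent : forall u : R,
  Re (phase s b z (t0 + W * u)) - Re (phase s b z t0) <= - D * u ^ 2.
Hypothesis contour_side : s = if Rlt_dec (Re W) 0 then Gamma_plus else Gamma_minus.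
Hypothesis saddle : (b = 4 * t0 * (z - t0))%C.

Lemma line_cut_plane (u : R) : cut_plane s (t0 + W * u)%C.
Proof. exact (saddle_line_cut_plane s b z t0 alpha D t0_neq_0 sin_alpha D_pos descent contour_side u). Qed.

Lemma line_neq_0 (u : R) : (t0 + W * u)%C <> 0%C.
Proof. exact (saddle_line_neq_0 t0 alpha t0_neq_0 sin_alpha u). Qed.

Lemma Cmod_W : Cmod W = Cmod t0.
Proof. unfold W, omega. rewrite Cmod_mult, Cmod_Cexp_Ci. ring. Qed.

(** If the two saddle points coincide, the exponent varies only to third order
    along the line and cannot decay quadratically. *)
Lemma saddle_nondegenerate : (4 * t0 ^ 2 - b)%C <> 0%C.
Proof.
  intros E.
  assert (Hb : (b = 4 * t0 * t0)%C).
  { replace b with (4 * t0 ^ 2 - (4 * t0 ^ 2 - b))%C by ring. rewrite E. simpl. ring. }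
  assert (Hz : (z = 2 * t0)%C).
  { assert (K : (4 * t0 * (z - 2 * t0) = 0)%C).
    { replace (4 * t0 * (z - 2 * t0))%C
        with (4 * t0 * (z - t0) - 4 * t0 * t0)%C by ring.
      rewrite <- saddle, <- Hb. ring. }
    destruct (Ceq_dec (z - 2 * t0) 0) as [K1 | K1].
    - replace z with ((z - 2 * t0) + 2 * t0)%C by ring. rewrite K1. ring.
    - exfalso. revert K. apply Cmult_neq_0; [apply Cmult_neq_0 |];
      [intros K; injection K; lra | exact t0_neq_0 | exact K1]. }
  assert (Ht := proj1 (Cmod_gt_0 t0) t0_neq_0).
  set (c := 2 * Cmod t0 ^ 2).
  assert (Hc : 0 < c) by (unfold c; generalize (pow_lt _ 2 Ht); lra).
  assert (H : forall u, 0 < u -> D * u ^ 2 <= c * u ^ 3).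
  { intros u Hu. assert (Hd := descent u).
    assert (M : Cmod (phase s b z (t0 + (W * u) * RtoC 1)
                      - phase s b z (t0 + (W * u) * RtoC 0)) <= c * u ^ 3).
    { apply (path_mean_value (fun x => phase s b z (t0 + (W * u) * RtoC x))
        (fun x => (z - (t0 + (W * u) * RtoC x)
                   - b / 4 / (t0 + (W * u) * RtoC x)) * (W * u))%C).
      intros x Hx.
      assert (Ex : (t0 + (W * u) * RtoC x)%C = (t0 + W * RtoC (u * x))%C)
        by (rewrite RtoC_mult; ring).
      assert (Hn := line_neq_0 (u * x)).
      assert (Hl := Cmod_saddle_line_ge t0 alpha sin_alpha (u * x)).
      fold omega in Hl. fold W in Hl.
      split.
      - apply (path_derive_comp (phase s b z) (fun x => (t0 + (W * u) * RtoC x)%C));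
          [| apply path_derive_affine].
        apply phase_hol_derive. rewrite Ex. apply line_cut_plane.
      - rewrite Ex.
        replace ((z - (t0 + W * RtoC (u * x)) - b / 4 / (t0 + W * RtoC (u * x))) * (W * u))%C
          with (- ((W * RtoC (u * x)) * (W * RtoC (u * x)) * (W * u)
                   / (t0 + W * RtoC (u * x))))%C
          by (rewrite Hb, Hz; field; exact Hn).
        rewrite Cmod_opp, Cmod_div by exact Hn.
        rewrite !Cmod_mult, !Cmod_R, Cmod_W, (Rabs_pos_eq u),
          (Rabs_pos_eq (u * x)) by (try apply Rmult_le_pos; lra).
        apply Rle_div_l; [lra |].
        assert (K : Cmod t0 * (u * x) * (Cmod t0 * (u * x)) * (Cmod t0 * u)
                    <= c * u ^ 3 * (Cmod t0 / 2)).
        { unfold c. replace (2 * Cmod t0 ^ 2 * u ^ 3 * (Cmod t0 / 2))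
            with (Cmod t0 ^ 3 * u ^ 3) by field.
          replace (Cmod t0 * (u * x) * (Cmod t0 * (u * x)) * (Cmod t0 * u))
            with (Cmod t0 ^ 3 * u ^ 3 * (x * x)) by ring.
          rewrite <- (Rmult_1_r (Cmod t0 ^ 3 * u ^ 3)) at 2.
          apply Rmult_le_compat_l; [| nra].
          apply Rmult_le_pos; apply Rlt_le, pow_lt; assumption. }
        eapply Rle_trans; [exact K |]. apply Rmult_le_compat_l; [| exact Hl].
        apply Rmult_le_pos; [lra | apply Rlt_le, pow_lt, Hu]. }
    replace (t0 + W * u * RtoC 1)%C with (t0 + W * u)%C in M by ring.
    replace (t0 + W * u * RtoC 0)%C with t0 in M by ring.
    assert (K := re_le_Cmod (phase s b z (t0 + W * u) - phase s b z t0)).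
    apply Rabs_le_between in K.
    change (Re (phase s b z (t0 + W * u) - phase s b z t0)%C)
      with (Re (phase s b z (t0 + W * u)) + - Re (phase s b z t0)) in K.
    lra. }
  specialize (H (D / (2 * c)) ltac:(apply Rdiv_lt_0_compat; lra)).
  assert (K : D * (D / (2 * c)) ^ 2 - c * (D / (2 * c)) ^ 3
              = D * (D / (2 * c)) ^ 2 / 2) by (field; lra).
  assert (P : 0 < D * (D / (2 * c)) ^ 2).
  { apply Rmult_lt_0_compat; [lra |]. apply pow_lt, Rdiv_lt_0_compat; lra. }
  lra.
Qed.

Hypothesis sq_sqr : (sq ^ 2 = 4 * t0 ^ 2 - b)%C.

Lemma sq_neq_0 : sq <> 0%C.
Proof.
  intros E. apply saddle_nondegenerate. rewrite <- sq_sqr, E. simpl. ring.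
Qed.

Hypothesis b_neq_0 : b <> 0%C.

Let c1 : C := (sq / t0)%C.
Let c0 : C := (4 * b / sq ^ 3 - sq)%C.
Let E (u : R) : C := Cexp (phase s b z (t0 + W * u)).
Let boundary (u : R) : C :=
  (4 * b * t0 / sq ^ 3 * ((0 - sq ^ 2 / b) + omega * RtoC u) * E u)%C.
Let cubic (u : R) : C :=
  (4 * b * t0 ^ 3 / sq ^ 3 * omega * ((omega * u) ^ 3 / (1 + omega * u)) * E u)%C.

Lemma one_plus_ray_neq_0 (u : R) : (1 + omega * u)%C <> 0%C.
Proof.
  apply Cmod_gt_0. generalize (Cmod_one_plus_ray_ge alpha u sin_alpha).
  fold omega. lra.
Qed.

Lemma E_derive (u : R) :
  path_derive E u
    (E u * ((z - (t0 + W * u) - b / 4 / (t0 + W * u)) * W))%C.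
Proof.
  apply (path_derive_comp Cexp (fun x => phase s b z (t0 + W * x)));
    [apply hol_derive_Cexp |].
  apply (path_derive_comp (phase s b z) (fun x => (t0 + W * RtoC x)%C));
    [apply phase_hol_derive, line_cut_plane | apply path_derive_affine].
Qed.

(** Two integrations by parts in one. The derivative [p] of the exponent in
    [tau] is [- sq ^ 2 / 4 * tau - b / 4 * tau ^ 2 / (1 + tau)]. Hence
    [p * exp] and [(1 + tau * p) * exp] are exact, and the constant
    [- sq ^ 2 / b] combines them so that the terms in [1] and [tau] are traded for
    one in [tau ^ 3 / (1 + tau)], which gains powers of the distance to the
    saddle point. *)
Lemma boundary_derive (u : R) :
  path_derive boundary u
    ((c0 + c1 * (t0 + W * u)) * E u * W - cubic u)%C.
Proof.
  assert (Hs := sq_neq_0). assert (Hn := line_neq_0 u).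
  assert (H1 := one_plus_ray_neq_0 u).
  evar_last.
  - apply path_derive_mult with
      (f := fun u => (4 * b * t0 / sq ^ 3 * ((0 - sq ^ 2 / b) + omega * RtoC u))%C)
      (g := E).
    + apply path_derive_mult with (f := fun _ : R => (4 * b * t0 / sq ^ 3)%C)
        (g := fun u => ((0 - sq ^ 2 / b) + omega * RtoC u)%C).
      * apply (is_derive_const (V := C_R_NormedModule)).
      * apply path_derive_affine.
    + apply E_derive.
  - change (zero : C_R_NormedModule) with (RtoC 0).
    assert (Ht : (t0 + W * u)%C = (t0 * (1 + omega * u))%C) by (unfold W; ring).
    rewrite Ht in Hn |- *.
    assert (Hz : z = (t0 + b / (4 * t0))%C).
    { rewrite saddle. field. exact t0_neq_0. }
    unfold cubic, c0, c1, W. rewrite Hz.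
    assert (Esq : (4 * b / sq ^ 3 - sq = (4 * b - (sq ^ 2) ^ 2) / sq ^ 3)%C)
      by (field; exact Hs).
    rewrite Esq.
    assert (Esq2 : (sq / t0 = (sq ^ 2) ^ 2 / (sq ^ 3 * t0))%C)
      by (field; split; [exact t0_neq_0 | exact Hs]).
    rewrite Esq2, sq_sqr. field.
    repeat split; assumption.
Qed.

Lemma Cmod_E_le (u : R) :
  Cmod (E u) <= exp (Re (phase s b z t0)) * exp (- D * u ^ 2).
Proof.
  unfold E. rewrite Cmod_Cexp, <- exp_plus. apply exp_le.
  generalize (descent u). lra.
Qed.

Lemma boundary_decays : decays boundary.
Proof.
  set (P := Cmod (4 * b * t0 / sq ^ 3) * exp (Re (phase s b z t0))).
  set (k := Cmod (0 - sq ^ 2 / b)).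
  assert (PP : 0 <= P) by (apply Rmult_le_pos; [apply Cmod_ge_0 | apply Rlt_le, exp_pos]).
  exists (P * exp (k + (1 + 1) ^ 2 / (4 * D))), 0.
  split; [apply Rmult_le_pos; [exact PP | apply Rlt_le, exp_pos] |].
  intros u _. unfold boundary. rewrite !Cmod_mult.
  assert (H1 : Cmod (0 - sq ^ 2 / b + omega * u) <= exp (k + Rabs u)).
  { eapply Rle_trans; [apply Cmod_triangle |].
    unfold omega. rewrite Cmod_mult, Cmod_Cexp_Ci, Cmod_R. fold k.
    assert (Pk : 0 <= k) by apply Cmod_ge_0.
    generalize (Rabs_le_exp (k + Rabs u)) (Rabs_pos u). intros A B.
    rewrite Rabs_pos_eq in A by lra. lra. }
  rewrite Rmult_assoc.
  apply Rle_trans with (Cmod (4 * b * t0 / sq ^ 3) *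
    (exp (k + Rabs u) * (exp (Re (phase s b z t0)) * exp (- D * u ^ 2)))).
  - apply Rmult_le_compat_l; [apply Cmod_ge_0 |].
    apply Rmult_le_compat; try apply Cmod_ge_0; [exact H1 | apply Cmod_E_le].
  - replace (Cmod (4 * b * t0 / sq ^ 3) *
      (exp (k + Rabs u) * (exp (Re (phase s b z t0)) * exp (- D * u ^ 2))))
      with (P * (exp (k + Rabs u) * exp (- D * u ^ 2))) by (unfold P; ring).
    rewrite Rmult_assoc. apply Rmult_le_compat_l; [exact PP |].
    rewrite <- exp_plus.
    eapply Rle_trans; [| apply (gaussian_le_exp 1 k D (Rabs u) D_pos)].
    right. f_equal. rewrite pow2_abs. ring.
Qed.

Lemma Cmod_cubic_le (u : R) :
  Cmod (cubic u) <=
    8 * Cmod b * Cmod t0 ^ 3 / Cmod sq ^ 3 * exp (Re (phase s b z t0))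
    * (Rabs u ^ 3 * exp (- D * u ^ 2)).
Proof.
  assert (Hs := sq_neq_0). assert (H1 := one_plus_ray_neq_0 u).
  assert (Hl := Cmod_one_plus_ray_ge alpha u sin_alpha). fold omega in Hl.
  assert (Hsp := proj1 (Cmod_gt_0 sq) Hs).
  assert (Hs3 : (sq ^ 3)%C <> 0%C).
  { apply Cmod_gt_0. rewrite Cmod_pow. apply pow_lt, Hsp. }
  unfold cubic.
  rewrite !Cmod_mult, !Cmod_div, !Cmod_mult, !Cmod_pow, Cmod_mult, !Cmod_R by assumption.
  assert (Ho : Cmod omega = 1) by apply Cmod_Cexp_Ci.
  rewrite Ho, (Rabs_pos_eq 4) by lra.
  set (k := 4 * Cmod b * Cmod t0 ^ 3 / Cmod sq ^ 3).
  assert (Pk : 0 <= k).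
  { unfold k. apply Rdiv_le_0_compat; [| apply pow_lt, Hsp].
    apply Rmult_le_pos; [generalize (Cmod_ge_0 b); lra | apply pow_le, Cmod_ge_0]. }
  assert (Q : (1 * Rabs u) ^ 3 / Cmod (1 + omega * u) <= 2 * Rabs u ^ 3).
  { rewrite Rmult_1_l. apply Rle_div_l; [lra |].
    assert (0 <= Rabs u ^ 3) by (apply pow_le, Rabs_pos). nra. }
  apply Rle_trans with (k * 1 * (2 * Rabs u ^ 3) *
     (exp (Re (phase s b z t0)) * exp (- D * u ^ 2))).
  - apply Rmult_le_compat; [| apply Cmod_ge_0 | | apply Cmod_E_le].
    + apply Rmult_le_pos; [lra |]. apply Rdiv_le_0_compat; [| lra].
      rewrite Rmult_1_l. apply pow_le, Rabs_pos.
    + apply Rmult_le_compat_l; [lra | exact Q].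
  - right. unfold k. field. lra.
Qed.

(** The boundary terms vanish in the limit, and the cubic remainder is
    integrated against the Gaussian majorant. *)
Lemma saddle_estimate (N : C) :
  is_line_int
    (fun x => ((c0 + c1 * gamma s x) * Cexp (phase s b z (gamma s x)))%C) N ->
  Cmod N <= 8 * Cmod b * Cmod t0 ^ 3 / Cmod sq ^ 3
            * exp (Re (phase s b z t0)) / D ^ 2.
Proof.
  intros HN.
  assert (Hdef := deformation s b z t0 alpha D t0_neq_0 sin_alpha D_pos descent
                    contour_side c0 c1 N HN).
  fold omega in Hdef. fold W in Hdef.
  set (N' := if Rlt_dec (Re W) 0 then (- N)%C else N) in Hdef.
  replace (Cmod N) with (Cmod N').
  2:{ unfold N'. destruct Rlt_dec; [apply Cmod_opp | reflexivity]. }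
  assert (HE : forall u, Ccontinuous E u).
  { intros u. apply (path_derive_continuous _ _ _ (E_derive u)). }
  assert (Hl : forall u, Ccontinuous (fun u : R => (c0 + c1 * (t0 + W * u))%C) u).
  { intros u. apply continuous_Cplus; [apply continuous_const |].
    apply continuous_Cmult; [apply continuous_const |].
    apply (path_derive_continuous _ _ _ (path_derive_affine t0 W u)). }
  assert (HG : forall u, Ccontinuous
             (fun u : R => ((c0 + c1 * (t0 + W * u)) * E u * W)%C) u).
  { intros u. apply continuous_Cmult; [| apply continuous_const].
    apply continuous_Cmult; [apply Hl | apply HE]. }
  assert (Hcub : forall u, Ccontinuous cubic u).
  { intros u. unfold cubic. apply continuous_Cmult; [| apply HE].
    apply continuous_Cmult; [apply continuous_const |].
    assert (Ho : Ccontinuous (fun u : R => (omega * u)%C) u).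
    { apply continuous_Cmult; [apply continuous_const |].
      apply continuous_RtoC, continuous_id. }
    unfold Cdiv. apply continuous_Cmult.
    - simpl. do 3 (apply continuous_Cmult; [exact Ho |]). apply continuous_const.
    - apply (continuous_comp (fun u : R => (1 + omega * u)%C) Cinv).
      + apply continuous_Cplus; [apply continuous_const | exact Ho].
      + apply continuous_Cinv, one_plus_ray_neq_0. }
  assert (Hlim := filterlim_C_plus _ _ (fun T => (- (boundary T - boundary (- T)%R))%C)
    _ (- 0)%C filter_filter Hdef
    (filterlim_comp _ _ _ _ Copp _ _ _ (decays_boundary boundary boundary_decays)
      (filterlim_opp (V := C_R_NormedModule) (RtoC 0)))).
  replace N' with (N' + - 0)%C by ring.
  refine (Cmod_lim_le _ _ _ _ _ Hlim _).
  exists 0. intros A HA.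
  apply (cubic_gaussian_int_le _ D A cubic); [exact D_pos | lra | apply Cmod_cubic_le
    | exact Hcub |].
  assert (HI : is_path_int (fun u : R => ((c0 + c1 * (t0 + W * u)) * E u * W - cubic u)%C)
                 (- A) A (boundary A - boundary (- A)%R)%C).
  { apply (is_RInt_derive (V := C_R_CompleteNormedModule)).
    - intros u _. apply boundary_derive.
    - intros u _. unfold Cminus.
      apply continuous_Cplus; [apply HG | apply continuous_Copp, Hcub]. }
  assert (HJ := is_RInt_minus (V := C_R_NormedModule) _ _ _ _ _ _
                  (is_path_int_continuous _ (- A) A HG) HI).
  eapply is_RInt_ext; [| exact HJ].
  intros u _. apply (@eq_trans C) with
    ((c0 + c1 * (t0 + W * u)) * E u * W
      - ((c0 + c1 * (t0 + W * u)) * E u * W - cubic u))%C; [reflexivity | ring].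
Qed.

End SaddleEstimate.

(** * The derivative of the ratio *)

Lemma hol_derive_caratheodory (f g q : C -> C) (z l : C) :
  hol_derive g z l -> CCcontinuous q z ->
  locally (T := C_UniformSpace) z
    (fun w => (f w - f z = (g w - g z) * q w)%C) ->
  hol_derive f z (l * q z)%C.
Proof.
  intros Hg Hq Hl.
  apply (hol_derive_ext_loc (fun w => (f z + (g w - g z) * q w)%C)).
  { revert Hl. apply filter_imp. intros w Hw. rewrite <- Hw. ring. }
  apply hol_derive_eps. intros eps.
  destruct (Cmod_posreal_bound (q z)) as [Q HQ].
  destruct (Cmod_posreal_bound l) as [M HM].
  assert (PQ := cond_pos Q). assert (PM := cond_pos M). assert (Pe := cond_pos eps).
  assert (He1 : 0 < eps / (2 * (Q + 1))) by (apply Rdiv_lt_0_compat; lra).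
  assert (He2 : 0 < Rmin 1 (eps / (2 * M))).
  { apply Rmin_pos; [lra |]. apply Rdiv_lt_0_compat; lra. }
  destruct (proj1 (hol_derive_eps _ _ _) Hg (mkposreal _ He1)) as [d1 H1].
  assert (Hc : locally (T := C_UniformSpace) z
                 (fun w => Cmod (q w - q z) < Rmin 1 (eps / (2 * M)))).
  { apply (Hq (fun v => Cmod (v - q z) < Rmin 1 (eps / (2 * M)))).
    apply locally_C_Cmod. exists (mkposreal _ He2). auto. }
  apply locally_C_Cmod in Hc. destruct Hc as [d2 H2]. cbn [pos] in H1.
  assert (Hd : 0 < Rmin d1 d2) by (apply Rmin_pos; apply cond_pos).
  exists (mkposreal _ Hd). cbn [pos]. intros w Hw.
  assert (Hw1 : Cmod (w - z) < d1) by (eapply Rlt_le_trans; [exact Hw | apply Rmin_l]).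
  assert (Hw2 : Cmod (w - z) < d2) by (eapply Rlt_le_trans; [exact Hw | apply Rmin_r]).
  specialize (H1 w Hw1). specialize (H2 w Hw2).
  assert (R1 := Rmin_l 1 (eps / (2 * M))). assert (R2 := Rmin_r 1 (eps / (2 * M))).
  replace (f z + (g w - g z) * q w - (f z + (g z - g z) * q z) - l * q z * (w - z))%C
    with ((g w - g z - l * (w - z)) * q w + l * (q w - q z) * (w - z))%C by ring.
  eapply Rle_trans; [apply Cmod_triangle |]. rewrite !Cmod_mult.
  assert (Hqw : Cmod (q w) <= Q + 1).
  { replace (q w) with ((q w - q z) + q z)%C by ring.
    eapply Rle_trans; [apply Cmod_triangle |]. lra. }
  assert (P0 := Cmod_ge_0 (w - z)).
  assert (T1 : Cmod (g w - g z - l * (w - z)) * Cmod (q w)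
               <= eps / (2 * (Q + 1)) * Cmod (w - z) * (Q + 1)).
  { apply Rmult_le_compat; try apply Cmod_ge_0; assumption. }
  assert (T2 : Cmod l * Cmod (q w - q z) <= M * (eps / (2 * M))).
  { apply Rmult_le_compat; try apply Cmod_ge_0; lra. }
  replace (eps / (2 * (Q + 1)) * Cmod (w - z) * (Q + 1)) with (eps / 2 * Cmod (w - z))
    in T1 by (field; lra).
  replace (M * (eps / (2 * M))) with (eps / 2) in T2 by (field; lra).
  nra.
Qed.

Lemma locally_neq_0 (f : C -> C) (z : C) :
  CCcontinuous f z -> f z <> 0%C ->
  locally (T := C_UniformSpace) z (fun w => f w <> 0%C).
Proof.
  intros Hf Hz. apply Cmod_gt_0 in Hz.
  apply (Hf (fun v : C => v <> RtoC 0)). apply locally_C_Cmod.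
  exists (mkposreal _ Hz). cbn [pos]. intros v Hv E. rewrite E in Hv.
  replace (RtoC 0 - f z)%C with (- f z)%C in Hv by ring. rewrite Cmod_opp in Hv. lra.
Qed.

Lemma sqrt_branch_sqr (g r : C -> C) (z : C) :
  sqrt_branch g z r -> (r z ^ 2)%C = g z.
Proof. intros H. apply (locally_singleton (T := C_UniformSpace) _ _ H). Qed.

Lemma sqrt_branch_continuous (g r : C -> C) (z : C) :
  sqrt_branch g z r -> CCcontinuous r z.
Proof. intros H. apply (locally_singleton (T := C_UniformSpace) _ _ H). Qed.

Lemma two_neq_0 : RtoC 2 <> 0%C.
Proof. intros E; injection E; lra. Qed.

(** The difference quotient of [r] is that of [g] divided by [r w + r z], which
    is continuous and not zero at [z]. *)
Lemma hol_derive_sqrt_branch (g r : C -> C) (z l : C) :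
  sqrt_branch g z r -> hol_derive g z l -> r z <> 0%C ->
  hol_derive r z (l / (2 * r z))%C.
Proof.
  intros Hr Hg Hz. assert (Hc := sqrt_branch_continuous _ _ _ Hr).
  assert (Hsum : CCcontinuous (fun w => (r w + r z)%C) z).
  { apply continuous_Cplus; [exact Hc | apply continuous_const]. }
  assert (H2 : (r z + r z)%C <> 0%C).
  { replace (r z + r z)%C with (2 * r z)%C by ring.
    apply Cmult_neq_0; [apply two_neq_0 | exact Hz]. }
  replace (l / (2 * r z))%C with (l * / (r z + r z))%C
    by (field; split; [exact Hz | exact H2] || (field; exact Hz)).
  apply (hol_derive_caratheodory r g (fun w => / (r w + r z))%C); [exact Hg | |].
  - apply (continuous_comp (fun w => (r w + r z)%C) Cinv); [exact Hsum |].
    apply continuous_Cinv, H2.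
  - generalize (filter_and _ _ Hr (locally_neq_0 _ _ Hsum H2)). apply filter_imp.
    intros w [[Hw _] Hn]. rewrite <- Hw, <- (sqrt_branch_sqr _ _ _ Hr).
    field. exact Hn.
Qed.

Lemma gaussian_first_order_int (s : contour) (b z c0 c1 m : C) :
  is_line_int (fun x => (gamma s x * gaussian_integrand s b z x)%C) m ->
  is_line_int
    (fun x => ((c0 + c1 * gamma s x) * Cexp (phase s b z (gamma s x)))%C)
    (c0 * gaussian_integral s b z + c1 * m)%C.
Proof.
  intros Hm.
  assert (H := is_RInt_gen_plus (V := C_R_NormedModule) _ _ _ _
    (is_line_int_Cmult c0 _ _ (gaussian_integral_correct s b z))
    (is_line_int_Cmult c1 _ _ Hm)).
  eapply (is_RInt_gen_ext (V := C_R_NormedModule)); [| exact H].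
  apply filter_forall. intros ab x _.
  change ((c0 * gaussian_integrand s b z x
           + c1 * (gamma s x * gaussian_integrand s b z x))%C
          = ((c0 + c1 * gamma s x) * Cexp (phase s b z (gamma s x)))%C).
  unfold gaussian_integrand. ring.
Qed.

Section Ratio.

Variables (s : contour) (a z : C) (r sq : C -> C).
Let b : C := (- (4 * (a - 1 / 2)))%C.
Let t0 (w : C) : C := (1 / 2 * (w + r w))%C.
Let d (w : C) : C := (- (t0 w ^ 2 / 2))%C.
Hypothesis b_neq_0 : b <> 0%C.
Hypothesis r_branch : sqrt_branch (fun w => (w ^ 2 - b)%C) z r.
Hypothesis sq_branch : sqrt_branch (fun w => (- (8 * d w) - b)%C) z sq.

Lemma saddle_equation (w : C) : (r w ^ 2 = w ^ 2 - b -> b = 4 * t0 w * (w - t0 w))%C.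
Proof.
  intros H. replace b with (w ^ 2 - (w ^ 2 - b))%C by ring. rewrite <- H.
  unfold t0. simpl. field.
Qed.

Lemma saddle_equation_z : (b = 4 * t0 z * (z - t0 z))%C.
Proof. apply saddle_equation, (sqrt_branch_sqr _ _ _ r_branch). Qed.

Lemma saddle_neq_0 : t0 z <> 0%C.
Proof. intros E. apply b_neq_0. rewrite saddle_equation_z, E. ring. Qed.

Lemma sq_sqr_saddle : (sq z ^ 2 = 4 * t0 z ^ 2 - b)%C.
Proof.
  rewrite (sqrt_branch_sqr _ _ _ sq_branch). unfold d. simpl. field.
Qed.

Lemma sq_sqr_product : (sq z ^ 2 = 4 * t0 z * r z)%C.
Proof.
  rewrite sq_sqr_saddle. rewrite saddle_equation_z at 1. unfold t0. simpl. field.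
Qed.

Hypothesis sq_z_neq_0 : sq z <> 0%C.

Lemma r_neq_0 : r z <> 0%C.
Proof.
  intros E. apply sq_z_neq_0. assert (K := sq_sqr_product). rewrite E in K.
  destruct (Ceq_dec (sq z) 0) as [|Hn]; [assumption | exfalso].
  apply (Cmult_neq_0 _ _ Hn Hn).
  replace (sq z * sq z)%C with (sq z ^ 2)%C by (simpl; ring). rewrite K. ring.
Qed.

Lemma hol_derive_sqr (z' : C) : hol_derive (fun w => (w ^ 2)%C) z' (2 * z')%C.
Proof.
  apply (hol_derive_ext_loc (fun w => (w * w)%C)).
  { apply filter_forall. intros w. simpl. ring. }
  evar_last; [apply hol_derive_mult; apply hol_derive_id |].
  apply (@eq_trans C) with (1 * z' + z' * 1)%C; [reflexivity | ring].
Qed.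

Lemma r_derive : hol_derive r z (z / r z)%C.
Proof.
  evar_last.
  - apply (hol_derive_sqrt_branch _ _ _ (2 * z - 0)%C r_branch).
    + apply hol_derive_minus; [apply hol_derive_sqr | apply hol_derive_const].
    + apply r_neq_0.
  - apply (@eq_trans C) with ((2 * z - 0) / (2 * r z))%C; [reflexivity |].
    field. apply r_neq_0.
Qed.

Lemma t0_derive : hol_derive t0 z (t0 z / r z)%C.
Proof.
  evar_last.
  - unfold t0. apply hol_derive_mult; [apply hol_derive_const |].
    apply hol_derive_plus; [apply hol_derive_id | apply r_derive].
  - apply (@eq_trans C) with (0 * (z + r z) + 1 / 2 * (1 + z / r z))%C; [reflexivity |].
    unfold t0. field. apply r_neq_0.
Qed.

Lemma d_derive : hol_derive d z (- (t0 z ^ 2 / r z))%C.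
Proof.
  apply (hol_derive_ext_loc (fun w => - (1 / 2) * (t0 w * t0 w))%C).
  { apply filter_forall. intros w. unfold d. simpl. field. }
  evar_last.
  - apply hol_derive_mult; [apply hol_derive_const |].
    apply hol_derive_mult; apply t0_derive.
  - apply (@eq_trans C) with
      (0 * (t0 z * t0 z) + - (1 / 2) * (t0 z / r z * t0 z + t0 z * (t0 z / r z)))%C;
      [reflexivity |].
    simpl. field. apply r_neq_0.
Qed.

Lemma sq_derive : hol_derive sq z (4 * t0 z ^ 2 / (r z * sq z))%C.
Proof.
  evar_last.
  - apply (hol_derive_sqrt_branch _ _ _
      (- (0 * d z + 8 * - (t0 z ^ 2 / r z)) - 0)%C sq_branch).
    + apply hol_derive_minus; [| apply hol_derive_const].
      apply hol_derive_opp. apply hol_derive_mult; [apply hol_derive_const |].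
      apply d_derive.
    + exact sq_z_neq_0.
  - apply (@eq_trans C) with
      ((- (0 * d z + 8 * - (t0 z ^ 2 / r z)) - 0) / (2 * sq z))%C; [reflexivity |].
    field. split; [exact sq_z_neq_0 | apply r_neq_0].
Qed.

Hypothesis saddle_cut_plane : cut_plane s (t0 z).

(** The saddle point being critical for the exponent, its motion does not
    contribute to the derivative of the critical value. *)
Lemma critical_value_derive : hol_derive (fun w => phase s b w (t0 w)) z (t0 z).
Proof.
  unfold phase.
  apply (hol_derive_ext_loc
    (fun w => w * t0 w - 1 / 2 * (t0 w * t0 w) - b / 4 * Clog_cont s (t0 w))%C).
  { apply filter_forall. intros w. simpl. field. }
  evar_last.
  - apply hol_derive_minus; [apply hol_derive_minus |].
    + apply hol_derive_mult; [apply hol_derive_id | apply t0_derive].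
    + apply hol_derive_mult; [apply hol_derive_const |].
      apply hol_derive_mult; apply t0_derive.
    + apply hol_derive_mult; [apply hol_derive_const |].
      apply (hol_derive_comp (Clog_cont s) t0);
        [apply hol_derive_Clog_cont, saddle_cut_plane | apply t0_derive].
  - apply (@eq_trans C) with
      (1 * t0 z + z * (t0 z / r z)
       - (0 * (t0 z * t0 z) + 1 / 2 * (t0 z / r z * t0 z + t0 z * (t0 z / r z)))
       - (0 * Clog_cont s (t0 z) + b / 4 * (t0 z / r z * / t0 z)))%C; [reflexivity |].
    rewrite saddle_equation_z. field.
    split; [apply saddle_neq_0 | apply r_neq_0].
Qed.

Let Utilde (w : C) : C :=
  (Cexp (- (w ^ 2 / 4) + phase s b w (t0 w)) * t0 w *
     (2 * RtoC (sqrt (2 * PI)) / sq w))%C.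

Let normalization : C := (2 * RtoC (sqrt (2 * PI)))%C.

Lemma normalization_neq_0 : normalization <> 0%C.
Proof.
  apply Cmult_neq_0; [apply two_neq_0 |]. intros E. injection E.
  generalize (sqrt_lt_R0 (2 * PI) ltac:(generalize PI_RGT_0; lra)). lra.
Qed.

(** As [t0' = t0 / r] and [sq' = 4 * t0 ^ 2 / (r * sq)], the derivative of
    [sq / t0] is [4 * b / sq ^ 3]; the term [- sq] comes from the critical value,
    and [m] from the derivative of the integral. *)
Lemma ratio_derive (m : C) :
  is_line_int (fun x => (gamma s x * gaussian_integrand s b z x)%C) m ->
  hol_derive (fun w => U s a w / Utilde w)%C z
    (Cexp (- phase s b z (t0 z)) / normalization *
     ((4 * b / sq z ^ 3 - sq z) * gaussian_integral s b z + sq z / t0 z * m))%C.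
Proof.
  intros Hm. assert (Hk := normalization_neq_0). assert (Hr := r_neq_0).
  assert (Ht := saddle_neq_0). assert (Hs := sq_z_neq_0).
  (* Near [z], division by [t0 w] is multiplication by [4 * (w - t0 w) / b]. *)
  apply (hol_derive_ext_loc (fun w => 4 / (b * normalization) * ((w - t0 w) * sq w *
     (Cexp (- phase s b w (t0 w)) * gaussian_integral s b w)))%C).
  { generalize (filter_and _ _ r_branch
      (locally_neq_0 sq z (sqrt_branch_continuous _ _ _ sq_branch) Hs)).
    apply filter_imp. intros w [[Hw _] Hsw].
    assert (Hb := saddle_equation w Hw).
    assert (Htw : t0 w <> 0%C).
    { intros E. apply b_neq_0. rewrite Hb, E. ring. }
    unfold Utilde. rewrite U_gaussian_integral. fold b. fold normalization.
    rewrite Cexp_plus, Cexp_opp.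
    assert (E1 := Cexp_neq_0 (- (w ^ 2 / 4))).
    assert (E2 := Cexp_neq_0 (phase s b w (t0 w))).
    assert (Q : (4 / (b * normalization) * (w - t0 w) = / (t0 w * normalization))%C).
    { assert (Hwt : (w - t0 w)%C <> 0%C).
      { intros E. apply b_neq_0. rewrite Hb, E. ring. }
      rewrite Hb at 1. field. repeat split; assumption. }
    replace (4 / (b * normalization) * ((w - t0 w) * sq w *
       (/ Cexp (phase s b w (t0 w)) * gaussian_integral s b w)))%C
      with ((4 / (b * normalization) * (w - t0 w)) * (sq w *
       (/ Cexp (phase s b w (t0 w)) * gaussian_integral s b w)))%C by ring.
    rewrite Q. field. repeat split; assumption. }
  evar_last.
  - apply hol_derive_mult; [apply hol_derive_const |].
    apply hol_derive_mult.
    + apply hol_derive_mult; [| apply sq_derive].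
      apply hol_derive_minus; [apply hol_derive_id | apply t0_derive].
    + apply hol_derive_mult; [| apply gaussian_integral_hol_derive, Hm].
      apply (hol_derive_comp Cexp (fun w => (- phase s b w (t0 w))%C));
        [apply hol_derive_Cexp |].
      apply hol_derive_opp, critical_value_derive.
  - set (V := gaussian_integral s b z). set (e := Cexp (- phase s b z (t0 z))).
    apply (@eq_trans C) with
      (0 * ((z - t0 z) * sq z * (e * V)) +
       4 / (b * normalization) *
        (((1 - t0 z / r z) * sq z + (z - t0 z) * (4 * t0 z ^ 2 / (r z * sq z)))
           * (e * V)
         + (z - t0 z) * sq z * (- t0 z * e * V + e * m)))%C; [reflexivity |].
    assert (Hz : (z = 2 * t0 z - r z)%C) by (unfold t0; field).
    assert (Hb : (b = 4 * t0 z * (t0 z - r z))%C).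
    { rewrite saddle_equation_z. rewrite Hz at 2. ring. }
    assert (Htr : (t0 z - r z)%C <> 0%C).
    { intros E. apply b_neq_0. rewrite Hb, E. ring. }
    assert (Hsq := sq_sqr_product).
    replace (z - t0 z)%C with (t0 z - r z)%C by (rewrite Hz at 3; ring).
    replace (4 * t0 z ^ 2 / (r z * sq z))%C
      with (4 * t0 z ^ 2 * sq z / (r z * sq z ^ 2))%C
      by (field; split; assumption).
    replace (4 * b / sq z ^ 3)%C
      with (4 * b * sq z / (sq z ^ 2 * sq z ^ 2))%C
      by (field; assumption).
    rewrite Hsq, Hb. field. repeat split; assumption.
Qed.

End Ratio.

Theorem theorem3p4 :
  forall (a z : C) (r sq : C -> C) (beta delta kappa alpha : R),
  (forall n : nat, a <> RtoC (INR n + 1 / 2)) ->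
  let b : C := (- (4 * (a - 1 / 2)))%C in
  (* r is a branch of sqrt (w^2 - b), with either sign *)
  sqrt_branch (fun w => (w ^ 2 - b)%C) z r ->
  let t0 : C -> C := fun w => (1 / 2 * (w + r w))%C in
  let d : C -> C := fun w => (- (t0 w ^ 2 / 2))%C in
  let rho : R := Cmod (b / (8 * d z))%C in
  - PI <= beta <= PI ->
  - PI <= delta <= PI ->
  b = (Cmod b * Cexp (Ci * beta))%C ->
  d z = (Cmod (d z) * Cexp (Ci * delta))%C ->
  is_kappa rho beta delta kappa ->
  0 < kappa ->
  let s : contour := contour_of (t0 z) alpha in
  corresponding_angle (phase s b z) (t0 z) (d z) kappa alpha ->
  (* sq is a branch of sqrt (- 8 d - b), with either sign *)
  sqrt_branch (fun w => (- (8 * d w) - b)%C) z sq ->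
  let Utilde : C -> C := fun w =>
    (Cexp (- (w ^ 2 / 4) + phase s b w (t0 w)) * t0 w *
     (2 * RtoC (sqrt (2 * PI)) / sq w))%C in
  let ratio : C -> C := fun w => (U s a w / Utilde w)%C in
  let D : R := kappa * Cmod (d z) in
  let L : R := ln (1 + Rpower D (3 / 2) / Cmod b) in
  let d' : C := C_derive d z in
  let q : R := sqrt (Cmod (8 * d z + b)%C) in
  ex_derive (K := C_AbsRing) (V := C_NormedModule) ratio z /\
  ex_derive (K := C_AbsRing) (V := C_NormedModule) d z /\
  Cmod (C_derive ratio z) <=
    Cmod b * Cmod d' / (kappa ^ 2 * Cmod (d z) ^ 2 * q) * (1 + L ^ 2) +
    Cmod b * Cmod d' / (kappa ^ 3 * Cmod (d z) ^ 3) * q * (1 + L ^ 3).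
Proof.
  intros a z r sq beta delta kappa alpha Ha b Hr t0 d rho _ _ _ _ _ Hkappa s
    [_ [Hsin Hangle]] Hsq Utilde ratio D L d' q.
  assert (Hb : b <> 0%C).
  { intros E. apply (Ha 0%nat). simpl INR. rewrite Rplus_0_l, RtoC_div by lra.
    replace a with (1 / 2 - (- (4 * (a - 1 / 2))) / 4)%C by field.
    fold b. rewrite E. field. }
  assert (Ht : t0 z <> 0%C) by exact (saddle_neq_0 a z r Hb Hr).
  assert (Hsaddle : (b = 4 * t0 z * (z - t0 z))%C) by exact (saddle_equation_z a z r Hr).
  assert (Htp := proj1 (Cmod_gt_0 _) Ht).
  assert (Hd : Cmod (d z) = Cmod (t0 z) ^ 2 / 2).
  { unfold d. rewrite Cmod_opp, Cmod_div by apply two_neq_0.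
    rewrite Cmod_pow, Cmod_R, Rabs_pos_eq by lra. reflexivity. }
  assert (Hdp : 0 < Cmod (d z)).
  { rewrite Hd. generalize (pow_lt _ 2 Htp). lra. }
  assert (HD : 0 < D) by (apply Rmult_lt_0_compat; assumption).
  assert (Hdescent : forall u : R,
    Re (phase s b z (t0 z + t0 z * Cexp (Ci * alpha) * u)) - Re (phase s b z (t0 z))
    <= - D * u ^ 2).
  { intros u. specialize (Hangle u). cbv zeta in Hangle.
    rewrite Cmod_mult, Cmod_Cexp_Ci, Cmod_R, Rmult_1_l, pow2_abs in Hangle.
    replace (t0 z + t0 z * Cexp (Ci * alpha) * u)%C
      with (t0 z * (1 + Cexp (Ci * alpha) * u))%C by ring.
    unfold D. rewrite Ropp_mult_distr_l.
    eapply Rle_trans; [| exact Hangle]. right. reflexivity. }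
  assert (Hside : s = if Rlt_dec (Re (t0 z * Cexp (Ci * alpha))%C) 0
                      then Gamma_plus else Gamma_minus) by reflexivity.
  assert (Hcut : cut_plane s (t0 z)).
  { replace (t0 z) with (t0 z + t0 z * Cexp (Ci * alpha) * RtoC 0)%C at 1 by ring.
    exact (line_cut_plane s b z (t0 z) alpha D Ht Hsin HD Hdescent Hside 0). }
  assert (Hsqs : (sq z ^ 2 = 4 * t0 z ^ 2 - b)%C) by exact (sq_sqr_saddle a z r sq Hsq).
  assert (Hsqp : (sq z ^ 2 = 4 * t0 z * r z)%C) by exact (sq_sqr_product a z r sq Hr Hsq).
  assert (Hs0 : sq z <> 0%C)
    by exact (sq_neq_0 s b z (t0 z) (sq z) alpha D Ht Hsin HD Hdescent Hside Hsaddle Hsqs).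
  assert (Hr0 : r z <> 0%C) by exact (r_neq_0 a z r sq Hr Hsq Hs0).
  destruct (gaussian_moment_exists s b z) as [m Hm].
  assert (Hratio := ratio_derive s a z r sq Hb Hr Hsq Hs0 Hcut m Hm).
  assert (Hdd : hol_derive d z (- (t0 z ^ 2 / r z))%C) by exact (d_derive a z r sq Hr Hsq Hs0).
  split; [eexists; exact Hratio |]. split; [eexists; exact Hdd |].
  assert (Hest := saddle_estimate s b z (t0 z) (sq z) alpha D Ht Hsin HD Hdescent
    Hside Hsaddle Hsqs Hb _ (gaussian_first_order_int s b z _ _ m Hm)).
  set (N := ((4 * b / sq z ^ 3 - sq z) * gaussian_integral s b z
             + sq z / t0 z * m)%C) in *.
  assert (E1 : C_derive ratio z
    = (Cexp (- phase s b z (t0 z)) / (2 * RtoC (sqrt (2 * PI))) * N)%C)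
    by exact (is_C_derive_unique _ _ _ Hratio).
  assert (E2 : d' = (- (t0 z ^ 2 / r z))%C) by exact (is_C_derive_unique _ _ _ Hdd).
  clearbody N. clear Hratio Hdd.
  assert (Pb := proj1 (Cmod_gt_0 _) Hb). assert (Ps := proj1 (Cmod_gt_0 _) Hs0).
  assert (Pr := proj1 (Cmod_gt_0 _) Hr0).
  assert (Eq : q = Cmod (sq z)).
  { unfold q. replace (8 * d z + b)%C with (- (sq z ^ 2))%C.
    2:{ rewrite Hsqs. unfold d. simpl. field. }
    rewrite Cmod_opp, Cmod_pow. apply sqrt_pow2. lra. }
  assert (Ed' : Cmod d' = Cmod (t0 z) ^ 2 / Cmod (r z)).
  { rewrite E2, Cmod_opp, Cmod_div, Cmod_pow by exact Hr0. reflexivity. }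
  assert (Esq : Cmod (sq z) ^ 2 = 4 * Cmod (t0 z) * Cmod (r z)).
  { rewrite <- Cmod_pow, Hsqp, !Cmod_mult, Cmod_R, Rabs_pos_eq by lra. reflexivity. }
  assert (Ecub : Cmod (t0 z) ^ 3 / Cmod (sq z) ^ 3 = Cmod d' / (4 * q)).
  { rewrite Ed', Eq.
    replace (Cmod (sq z) ^ 3) with (Cmod (sq z) ^ 2 * Cmod (sq z)) by ring.
    rewrite Esq. field. lra. }
  assert (HP : 1 <= sqrt (2 * PI)).
  { rewrite <- sqrt_1. apply sqrt_le_1_alt. generalize PI2_3_2. unfold PI2. lra. }
  assert (Hmain : Cmod (C_derive ratio z) <= Cmod b * Cmod d' / (D ^ 2 * q)).
  { assert (Hk : Cmod (2 * RtoC (sqrt (2 * PI))) = 2 * sqrt (2 * PI)).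
    { rewrite Cmod_mult, !Cmod_R, !Rabs_pos_eq by lra. reflexivity. }
    assert (Hk0 : (2 * RtoC (sqrt (2 * PI)))%C <> 0%C).
    { apply Cmod_gt_0. rewrite Hk. lra. }
    rewrite E1, Cmod_mult, Cmod_div, Hk, Cmod_Cexp by exact Hk0.
    change (Re (- phase s b z (t0 z))%C) with (- Re (phase s b z (t0 z))).
    set (f0 := Re (phase s b z (t0 z))) in *.
    assert (Qp : 0 < q) by lra.
    assert (T : 0 <= Cmod b * Cmod d' / (D ^ 2 * q)).
    { apply Rdiv_le_0_compat; [apply Rmult_le_pos; [lra | apply Cmod_ge_0] |].
      apply Rmult_lt_0_compat; [apply pow_lt, HD | exact Qp]. }
    apply Rle_trans with (exp (- f0) / (2 * sqrt (2 * PI)) *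
      (8 * Cmod b * Cmod (t0 z) ^ 3 / Cmod (sq z) ^ 3 * exp f0 / D ^ 2)).
    { apply Rmult_le_compat_l; [| exact Hest].
      apply Rdiv_le_0_compat; [apply Rlt_le, exp_pos | lra]. }
    replace (8 * Cmod b * Cmod (t0 z) ^ 3 / Cmod (sq z) ^ 3)
      with (8 * Cmod b * (Cmod (t0 z) ^ 3 / Cmod (sq z) ^ 3)) by (field; lra).
    rewrite Ecub, exp_Ropp.
    replace (/ exp f0 / (2 * sqrt (2 * PI)) *
             (8 * Cmod b * (Cmod d' / (4 * q)) * exp f0 / D ^ 2))
      with (Cmod b * Cmod d' / (D ^ 2 * q) * / sqrt (2 * PI)).
    2:{ field. generalize (exp_pos f0). lra. }
    rewrite <- (Rmult_1_r (Cmod b * Cmod d' / (D ^ 2 * q))) at 2.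
    apply Rmult_le_compat_l; [exact T |].
    rewrite <- Rinv_1. apply Rinv_le_contravar; lra. }
  assert (HL : 0 <= L).
  { unfold L. rewrite <- ln_1. apply ln_le; [lra |].
    assert (0 < Rpower D (3 / 2) / Cmod b)
      by (apply Rdiv_lt_0_compat; [apply exp_pos | exact Pb]).
    lra. }
  eapply Rle_trans; [exact Hmain |].
  assert (Pd' := Cmod_ge_0 d').
  assert (T1 : 0 <= Cmod b * Cmod d' / (kappa ^ 2 * Cmod (d z) ^ 2 * q)).
  { apply Rdiv_le_0_compat; [apply Rmult_le_pos; lra |].
    apply Rmult_lt_0_compat; [| lra].
    apply Rmult_lt_0_compat; apply pow_lt; assumption. }
  assert (T2 : 0 <= Cmod b * Cmod d' / (kappa ^ 3 * Cmod (d z) ^ 3) * q * (1 + L ^ 3)).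
  { apply Rmult_le_pos; [| generalize (pow_le _ 3 HL); lra].
    apply Rmult_le_pos; [| lra].
    apply Rdiv_le_0_compat; [apply Rmult_le_pos; lra |].
    apply Rmult_lt_0_compat; apply pow_lt; assumption. }
  replace (D ^ 2 * q) with (kappa ^ 2 * Cmod (d z) ^ 2 * q) by (unfold D; ring).
  assert (T3 := Rmult_le_pos _ _ T1 (pow2_ge_0 L)).
  lra.
Qed.
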